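(* Let $p$ be a prime, let $\alpha_1,\alpha_2\in\mathbb{C}_p$, and let $F$ be the differential polynomial \[ F = x^{(2)} - (\alpha_1+\alpha_2)\,x^{(1)} + \alpha_1\alpha_2\, x \in \mathbb{C}_p[\![t]\!]\{x\}. \] If $\nu_p(\alpha_1)\neq\nu_p(\alpha_2)$, then the set $\{F\}$ is a differential tropical basis for the differential ideal $[F]$, i.e. \[ \mathcal{S}(\operatorname{trop}([F])) = \bigcap_{n\in\mathbb{N}} \mathcal{S}(\operatorname{trop}(d^nF)). \]
   Context: $\mathbb{N}=\{0,1,2,\dots\}$. $(\mathbb{C}_p,\nu_p)$ is the field of $p$-adic complex numbers with its $p$-adic valuation, $\nu_p(0)=\infty$. **Differential polynomials.** For a field $K$, $K[\![t]\!]\{x\}$ is the polynomial ring $K[\![t]\!][x^{(j)}\mid j\in\mathbb{N}]$ (with $x=x^{(0)}$), equipped with the unique derivation $d$ that extends $d/dt$ on $K[\![t]\!]$ and satisfies $d x^{(j)}=x^{(j+1)}$. For $f\in K[\![t]\!]\{x\}$, $[f]$ is the smallest differential ideal containing $f$, i.e. the ideal generated by $\{d^nf\mid n\in\mathbb{N}\}$. **Tropical semirings.** $\mathbb{T}=(\mathbb{R}\cup\{\infty\},\min,+)$ and $\mathbb{T}^{(2)}=(\mathbb{R}^2\cup\{\infty\},\min_{\mathrm{lex}},+)$, where $\min_{\mathrm{lex}}$ is the minimum for the lexicographic order on $\mathbb{R}^2$ and $\infty$ is the largest element. **Tropicalization of equations.** Let $K=\mathbb{C}_p$ and $v_K=\nu_p$.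 Define $v:K[\![t]\!]\to\mathbb{T}^{(2)}$ by $v(\sum_i a_it^i)=(m,v_K(a_m))$, where $m=\min\{i\mid a_i\neq 0\}$, and $v(0)=\infty$. For $f\in K[\![t]\!]\{x\}$, $\operatorname{trop}(f)\in\mathbb{T}^{(2)}[x^{(j)}\mid j\in\mathbb{N}]$ is obtained by applying $v$ to the coefficients of $f$. For a differential ideal $I$, $\operatorname{trop}(I)=\{\operatorname{trop}(f)\mid f\in I\}$. **Tropical solutions.** $\mathbb{T}[\![t]\!]$ is the semiring of formal power series $B=\sum_{i\ge 0}b_it^i$ with $b_i\in\mathbb{T}$. It carries the additive, $\mathbb{T}$-linear differential $(d/dt)_{v_K}$ given by $t^n\mapsto v_K(n)t^{n-1}$ for $n\ge1$ and $t^0\mapsto\infty$; thus the coefficient of $t^{n-1}$ in $(d/dt)_{v_K}(B)$ is $b_n+v_K(n)$. Define $w:\mathbb{T}[\![t]\!]\to\mathbb{T}^{(2)}$ by $w(B)=(m,b_m)$ with $m=\min\{i\mid b_i\neq\infty\}$, and $w(B)=\infty$ if all $b_i=\infty$. A polynomial $f\in\mathbb{T}^{(2)}[x^{(j)}\mid j\in\mathbb{N}]$ is evaluated at $B$ by substituting $w\big((d/dt)_{v_K}^j(B)\big)$ for $x^{(j)}$. $B$ is a tropical solution of $f$ if the resulting minimum, taken in $\mathbb{T}^{(2)}$ over the monomial terms of $f$, is attained at least twice. $\mathcal{S}(f)\subseteq\mathbb{T}[\![t]\!]$ is the set of tropical solutions of $f$, and for a set $J$ of such polynomials $\mathcal{S}(J)=\bigcap_{f\in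 J}\mathcal{S}(f)$. **Differential tropical basis.** A differential tropical basis of a differential ideal $I$ is a set $\{F_\lambda\}_{\lambda\in\Lambda}\subset I$ with $\mathcal{S}(\operatorname{trop}(I))=\bigcap_{\lambda\in\Lambda}\bigcap_{n\in\mathbb{N}}\mathcal{S}(\operatorname{trop}(d^nF_\lambda))$. *)

(* Defs.v *)
From HB Require Import structures.
From mathcomp Require Import all_boot all_order all_algebra finmap.
From mathcomp Require Import boolp classical_sets reals.
From mathcomp Require Import monalg.

Set Implicit Arguments.
Unset Strict Implicit.
Unset Printing Implicit Defensive.

Import Order.TTheory GRing.Theory Num.Theory.

Local Open Scope classical_set_scope.
Local Open Scope ring_scope.

(* Tropical arithmetic on [option G] for a totally ordered abelian group G,
   [None] being the point at infinity, i.e. the largest element. *)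
Section TropicalOperations.
Variables (G : zmodType) (le : rel G).

Definition tle (x y : option G) : bool :=
  match x, y with
  | _, None => true
  | None, Some _ => false
  | Some a, Some b => le a b
  end.

Definition tmin (x y : option G) : option G := if tle x y then x else y.

Definition tplus (x y : option G) : option G :=
  match x, y with
  | Some a, Some b => Some (a + b)
  | _, _ => None
  end.

Hypothesis le_total : total le.
Hypothesis le_anti : antisymmetric le.
Hypothesis le_trans : transitive le.
Hypothesis le_add : forall z x y, le (x + z) (y + z) = le x y.

Let tle_total : total tle.
Proof. by move=> [a|] [b|] //=. Qed.

Let tle_anti : antisymmetric tle.
Proof. by move=> [a|] [b|] //= /le_anti->. Qed.

Let tle_trans : transitive tle.
Proof. by move=> [a|] [b|] [c|] //=; exact: le_trans. Qed.

Lemma tminC : commutative tmin.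
Proof.
move=> x y; rewrite /tmin; case: ifP => xy; case: ifP => yx //.
- by apply: tle_anti; rewrite xy yx.
- by have := tle_total x y; rewrite xy yx.
Qed.

Lemma tminA : associative tmin.
Proof.
move=> x y z; rewrite /tmin.
case yz: (tle y z); case xy: (tle x y); rewrite ?yz ?(tle_trans xy yz) ?xy //.
case xz: (tle x z) => //.
have zy : tle z y by have := tle_total y z; rewrite yz.
by rewrite (tle_trans xz zy) in xy.
Qed.

Lemma tmin0 : left_id None tmin.
Proof. by move=> [a|]. Qed.

Lemma tplusA : associative tplus.
Proof. by move=> [a|] [b|] [c|] //=; rewrite addrA. Qed.

Lemma tplusC : commutative tplus.
Proof. by move=> [a|] [b|] //=; rewrite addrC. Qed.

Lemma tplus1 : left_id (Some 0) tplus.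
Proof. by move=> [a|] //=; rewrite add0r. Qed.

Lemma tplusDl : left_distributive tplus tmin.
Proof.
move=> [a|] [b|] [c|] //=; rewrite /tmin /= ?le_add //;
  by case: (le a b).
Qed.

Lemma tplus0 : left_zero None tplus.
Proof. by []. Qed.

End TropicalOperations.

(* T = (R u {oo}, min, +).  As an element of a semiring, oo is written [0] (or
   [None]), the real number 0 is written [1], [+%R] is the minimum and [*%R] is
   the addition of real numbers. *)
Definition trop (R : realType) : Type := option R.

Section Trop.
Variable R : realType.

HB.instance Definition _ := Choice.on (trop R).

Let le : rel R := <=%R.
Let le_total : total le. Proof. exact: le_total. Qed.
Let le_anti : antisymmetric le. Proof. exact: le_anti. Qed.
Let le_trans : transitive le. Proof. exact: le_trans. Qed.
Let le_add z x y : le (x + z) (y + z) = le x y. Proof. exact: lerD2r. Qed.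

HB.instance Definition _ := GRing.isNmodule.Build (trop R)
  (tminA le_total le_trans) (tminC le_total le_anti) (tmin0 le).

Fact trop1_neq0 : (Some 0 : trop R) != (0 : trop R).
Proof. by []. Qed.

HB.instance Definition _ := GRing.Nmodule_isComNzSemiRing.Build (trop R)
  (@tplusA R) (@tplusC R) (@tplus1 R) (tplusDl le_add) (@tplus0 R) trop1_neq0.

End Trop.

Definition trop_le (R : realType) : rel (trop R) := tle <=%R.

(* T^(2) = (R^2 u {oo}, min_lex, +), with the same conventions. *)
Definition trop2 (R : realType) : Type := option (R * R).

Section Trop2.
Variable R : realType.

HB.instance Definition _ := Choice.on (trop2 R).

Definition lex2 : rel (R * R) := fun x y =>
  (x <= y :> (R *l R))%O.

Let le_total : total lex2. Proof. by move=> x y; exact: le_total. Qed.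
Let le_anti : antisymmetric lex2. Proof. by move=> x y; exact: le_anti. Qed.
Let le_trans : transitive lex2. Proof. by move=> x y z; exact: le_trans. Qed.
Let le_add z x y : lex2 (x + z) (y + z) = lex2 x y.
Proof. by rewrite /lex2 !leEprodlexi /= !lerD2r. Qed.

HB.instance Definition _ := GRing.isNmodule.Build (trop2 R)
  (tminA le_total le_trans) (tminC le_total le_anti) (tmin0 lex2).

Fact trop2_1_neq0 : (Some 0 : trop2 R) != (0 : trop2 R).
Proof. by []. Qed.

HB.instance Definition _ := GRing.Nmodule_isComNzSemiRing.Build (trop2 R)
  (@tplusA (R * R)%type) (@tplusC _) (@tplus1 _) (tplusDl le_add) (@tplus0 _)
  trop2_1_neq0.

End Trop2.

(* A[[t]]; [a n] is the coefficient of t^n in [a : fps A]. *)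
Record fps (A : Type) : Type := Fps { fps_coef :> nat -> A }.

Lemma fpsP (A : Type) (a b : fps A) : (forall n, a n = b n) -> a = b.
Proof. by case: a b => [a] [b] /= /funext->. Qed.

HB.instance Definition _ (A : Type) := gen_eqMixin (fps A).
HB.instance Definition _ (A : Type) := gen_choiceMixin (fps A).

Section FpsNmodule.
Variable A : nmodType.
Implicit Types a b c : fps A.

Definition fps_zero : fps A := Fps (fun=> 0).
Definition fps_add a b : fps A := Fps (fun n => a n + b n).

Fact fps_addA : associative fps_add.
Proof. by move=> a b c; apply: fpsP => n /=; rewrite addrA. Qed.
Fact fps_addC : commutative fps_add.
Proof. by move=> a b; apply: fpsP => n /=; rewrite addrC. Qed.
Fact fps_add0 : left_id fps_zero fps_add.
Proof. by move=> a; apply: fpsP => n /=; rewrite add0r. Qed.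

HB.instance Definition _ :=
  GRing.isNmodule.Build (fps A) fps_addA fps_addC fps_add0.

Lemma fps_coef0 n : (0 : fps A) n = 0. Proof. by []. Qed.
Lemma fps_coefD a b n : (a + b) n = a n + b n. Proof. by []. Qed.

End FpsNmodule.

Section FpsSemiRing.
Variable A : nzSemiRingType.
Implicit Types a b c : fps A.

Definition fpsC (x : A) : fps A := Fps (fun n => if n is 0%N then x else 0).
Definition fps_mul a b : fps A :=
  Fps (fun n => \sum_(j < n.+1) a j * b (n - j)%N).

Let fps_coef_mul_rev a b n :
  fps_mul a b n = \sum_(j < n.+1) a (n - j)%N * b j.
Proof.
rewrite /= (reindex_inj rev_ord_inj) /=.
by apply: eq_bigr => j _; rewrite (sub_ordK j).
Qed.

Fact fps_mulA : associative fps_mul.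
Proof.
move=> p q r; apply: fpsP => i; rewrite [RHS]fps_coef_mul_rev [LHS]/=.
pose coef3 j k := p j * (q (i - j - k)%N * r k).
transitivity (\sum_(j < i.+1) \sum_(k < i.+1 | (k <= i - j)%N) coef3 j k).
  apply: eq_bigr => /= j _.
  rewrite -[\sum_(_ < _) _]/(fps_mul q r (i - j)%N) fps_coef_mul_rev big_distrr.
  by rewrite (big_ord_narrow_leq (leq_subr _ _)).
rewrite (exchange_big_dep predT) //=; apply: eq_bigr => k _.
transitivity (\sum_(j < i.+1 | (j <= i - k)%N) coef3 j k).
  apply: eq_bigl => j; rewrite -ltnS -(ltnS j) -!subSn ?leq_ord //.
  by rewrite -subn_gt0 -(subn_gt0 j) -!subnDA addnC.
rewrite (big_ord_narrow_leq (leq_subr _ _)) big_distrl /=.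
by apply: eq_bigr => j _; rewrite /coef3 -!subnDA addnC mulrA.
Qed.

Fact fps_mul1 : left_id (fpsC 1) fps_mul.
Proof.
move=> a; apply: fpsP => n /=; rewrite big_ord_recl subn0 mul1r big1 ?addr0 //.
by move=> j _; rewrite mul0r.
Qed.

Fact fps_mulr1 : right_id (fpsC 1) fps_mul.
Proof.
move=> a; apply: fpsP => n; rewrite fps_coef_mul_rev big_ord_recl subn0 mulr1.
by rewrite big1 ?addr0 // => j _; rewrite mulr0.
Qed.

Fact fps_mulDl : left_distributive fps_mul +%R.
Proof.
move=> a b c; apply: fpsP => n; rewrite fps_coefD -big_split.
by apply: eq_bigr => j _; rewrite mulrDl.
Qed.

Fact fps_mulDr : right_distributive fps_mul +%R.
Proof.
move=> a b c; apply: fpsP => n; rewrite fps_coefD -big_split.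
by apply: eq_bigr => j _; rewrite mulrDr.
Qed.

Fact fps_mul0 : left_zero 0 fps_mul.
Proof. by move=> a; apply: fpsP => n; apply: big1 => j _; rewrite mul0r. Qed.

Fact fps_mulr0 : right_zero 0 fps_mul.
Proof. by move=> a; apply: fpsP => n; apply: big1 => j _; rewrite mulr0. Qed.

Fact fps1_neq0 : fpsC 1 != 0.
Proof. by apply/eqP => /(congr1 (@fps_coef A))/(congr1 (@^~ 0%N))/eqP; rewrite oner_eq0. Qed.

HB.instance Definition _ := GRing.Nmodule_isNzSemiRing.Build (fps A)
  fps_mulA fps_mul1 fps_mulr1 fps_mulDl fps_mulDr fps_mul0 fps_mulr0 fps1_neq0.

Lemma fps_coefM a b n : (a * b) n = \sum_(j < n.+1) a j * b (n - j)%N.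
Proof. by []. Qed.

End FpsSemiRing.

Section FpsComSemiRing.
Variable A : comNzSemiRingType.

Fact fps_mulC : commutative (@GRing.mul (fps A)).
Proof.
move=> a b; apply: fpsP => n; rewrite !fps_coefM (reindex_inj rev_ord_inj) /=.
by apply: eq_bigr => j _; rewrite (sub_ordK j) mulrC.
Qed.

HB.instance Definition _ :=
  GRing.SemiRing_hasCommutativeMul.Build (fps A) fps_mulC.

End FpsComSemiRing.

Section FpsZmodule.
Variable A : zmodType.

Definition fps_opp (a : fps A) : fps A := Fps (fun n => - a n).

Fact fps_addN : left_inverse 0 fps_opp +%R.
Proof. by move=> a; apply: fpsP => n; rewrite fps_coefD addNr. Qed.

HB.instance Definition _ := GRing.Nmodule_isZmodule.Build (fps A) fps_addN.

End FpsZmodule.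

HB.instance Definition _ (A : nzRingType) := GRing.Zmodule.on (fps A).
HB.instance Definition _ (A : comNzRingType) := GRing.Zmodule.on (fps A).

Section FpsDerivation.
Variable A : nzRingType.
Implicit Types a b : fps A.

Definition fps_deriv a : fps A := Fps (fun n => a n.+1 *+ n.+1).

Lemma fps_derivD a b : fps_deriv (a + b) = fps_deriv a + fps_deriv b.
Proof. by apply: fpsP => n; rewrite fps_coefD /= mulrnDl. Qed.

Lemma fps_derivM a b :
  fps_deriv (a * b) = fps_deriv a * b + a * fps_deriv b.
Proof.
apply: fpsP => n; rewrite fps_coefD [LHS]/= !fps_coefM.
have -> : (\sum_(j < n.+2) a j * b (n.+1 - j)%N) *+ n.+1 =
    \sum_(j < n.+2) (a j * b (n.+1 - j)%N) *+ j +
    \sum_(j < n.+2) (a j * b (n.+1 - j)%N) *+ (n.+1 - j).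
  rewrite -sumrMnl -big_split /=; apply: eq_bigr => j _.
  by rewrite -mulrnDr subnKC // -ltnS.
congr (_ + _).
  rewrite big_ord_recl mulr0n add0r; apply: eq_bigr => j _ /=.
  by rewrite mulrnAl.
rewrite big_ord_recr /= subnn mulr0n addr0; apply: eq_bigr => j _ /=.
by rewrite subSn 1?mulrnAr // -ltnS.
Qed.

End FpsDerivation.

(* A{x}, for a differential ring (A, delta).  The power products of the
   variables x^(j) are the monomials of [{cmonom nat}], where the exponent of
   x^(j) in [m] is [m j]. *)
Notation "{ 'dpoly' A }" := {malg A[{cmonom nat}]}
  (at level 0, A at level 2, format "{ 'dpoly'  A }") : type_scope.

Section DifferentialPolynomials.
Variables (A : comNzRingType) (delta : A -> A).
Implicit Types (f g : {dpoly A}) (a b : A) (m : {cmonom nat}).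

Definition dvar (j : nat) : {dpoly A} := << ucm j >>.

(* d m = \sum_j m(j) (m / x^(j)) x^(j+1) *)
Definition dmonom_deriv m : {dpoly A} :=
  \sum_(j <- finsupp m)
    << (m j)%:R *g mmul (divcm m (ucm j)) (ucm j.+1) >>.

Definition dpoly_deriv f : {dpoly A} :=
  \sum_(m <- msupp f)
    (<< delta f@_m *g m >> + f@_m *: dmonom_deriv m).

Hypothesis deltaD : forall a b, delta (a + b) = delta a + delta b.
Hypothesis deltaM : forall a b, delta (a * b) = delta a * b + a * delta b.

Let D1 m a : {dpoly A} := << delta a *g m >> + a *: dmonom_deriv m.

Let D1D m a b : D1 m (a + b) = D1 m a + D1 m b.
Proof. by rewrite /D1 deltaD monalgUD scalerDl addrACA. Qed.

Let D10 m : D1 m 0 = 0.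
Proof. by apply: (addrI (D1 m 0)); rewrite -D1D !addr0. Qed.

Let dpoly_derivEw (e : {fset {cmonom nat}}) f : (msupp f `<=` e)%fset ->
  dpoly_deriv f = \sum_(m <- e) D1 m f@_m.
Proof.
move=> le_e; apply: big_fset_incl => // m _ /mcoeff_outdom ->.
exact: D10.
Qed.

Lemma dpoly_derivD f g : dpoly_deriv (f + g) = dpoly_deriv f + dpoly_deriv g.
Proof.
rewrite (dpoly_derivEw (msuppD_le f g)).
rewrite (dpoly_derivEw (fsubsetUl (msupp f) (msupp g))).
rewrite (dpoly_derivEw (fsubsetUr (msupp f) (msupp g))) -big_split /=.
by apply: eq_bigr => m _; rewrite mcoeffD D1D.
Qed.

Lemma dpoly_deriv0 : dpoly_deriv 0 = 0.
Proof. by apply: (addrI (dpoly_deriv 0)); rewrite -dpoly_derivD !addr0. Qed.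

Lemma dpoly_deriv_sum (I : Type) (r : seq I) (F : I -> {dpoly A}) :
  dpoly_deriv (\sum_(i <- r) F i) = \sum_(i <- r) dpoly_deriv (F i).
Proof. exact: (big_morph _ dpoly_derivD dpoly_deriv0). Qed.

Lemma dpoly_derivU a m :
  dpoly_deriv << a *g m >> = << delta a *g m >> + a *: dmonom_deriv m.
Proof. by rewrite (dpoly_derivEw msuppU_le) big_seq_fset1 mcoeffUU. Qed.

Let dmonomEw (e : {fset nat}) m : (finsupp m `<=` e)%fset ->
  dmonom_deriv m =
  \sum_(j <- e) << (m j)%:R *g mmul (divcm m (ucm j)) (ucm j.+1) >>.
Proof.
move=> le_e; apply: big_fset_incl => // j _.
by rewrite -cmE_eq0 => /eqP->; rewrite monalgU0.
Qed.

Let monalgUM a b m k :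
  << a *g m >> * << b *g k >> = << a * b *g mmul m k >> :> {dpoly A}.
Proof. by rewrite malgM_def fgmulUU. Qed.

Let monalgUMr a m k :
  << a *g m >> * << k >> = << a *g mmul m k >> :> {dpoly A}.
Proof. by rewrite monalgUM; congr << _ *g _ >>; exact: mulr1. Qed.

Let monalgUMl a m k :
  << m >> * << a *g k >> = << a *g mmul m k >> :> {dpoly A}.
Proof. by rewrite monalgUM; congr << _ *g _ >>; exact: mul1r. Qed.

Let UD m a b : << a + b *g m >> = << a *g m >> + << b *g m >> :> {dpoly A}.
Proof. exact: monalgUD. Qed.

Let dmonom_derivM m1 m2 : dmonom_deriv (mmul m1 m2) =
  dmonom_deriv m1 * << m2 >> + << m1 >> * dmonom_deriv m2.
Proof.
have [m defm] : exists m, m = mmul m1 m2 by exists (mmul m1 m2).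
have le1 : (finsupp m1 `<=` finsupp m)%fset by rewrite defm mdomD fsubsetUl.
have le2 : (finsupp m2 `<=` finsupp m)%fset by rewrite defm mdomD fsubsetUr.
rewrite -defm.
have e0 := dmonomEw (fsubset_refl (finsupp m)).
have e1 := dmonomEw le1.
have e2 := dmonomEw le2.
rewrite e0 e1 e2 mulr_suml [X in _ = _ + X]mulr_sumr -big_split /=.
apply: eq_bigr => j _.
rewrite [X in _ = X + _]monalgUMr [X in _ = _ + X]monalgUMl.
have -> : (m j)%:R = (m1 j)%:R + (m2 j)%:R :> A by rewrite defm cmM natrD.
rewrite UD.
apply: (f_equal2 +%R).
  have [->|m1j] := eqVneq (m1 j) 0%N; first by rewrite !monalgU0.
  apply: (congr1 (mkmalgU ^~ _)); apply/eqP/cmP => i.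
  rewrite defm !(cmM, divcmE, cmU).
  case: (eqVneq j i) => [<-|_]; rewrite ?subn0; last by rewrite addnAC.
  by rewrite -addnBAC ?lt0n // addnAC.
have [->|m2j] := eqVneq (m2 j) 0%N; first by rewrite !monalgU0.
apply: (congr1 (mkmalgU ^~ _)); apply/eqP/cmP => i.
rewrite defm !(cmM, divcmE, cmU).
case: (eqVneq j i) => [<-|_]; rewrite ?subn0; last by rewrite addnA.
by rewrite -addnBA ?lt0n // addnA.
Qed.

Let UZ c m : << c *g m >> = c *: << m >> :> {dpoly A}.
Proof.
by apply/malgP => l; rewrite [RHS]mcoeffZ [LHS]mcoeffU mcoeffU mulrnAr mulr1.
Qed.

Let UM m k : << mmul m k >> = << m >> * << k >> :> {dpoly A}.
Proof. by rewrite monalgUMr. Qed.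

Let DU c m : dpoly_deriv << c *g m >> = delta c *: << m >> + c *: dmonom_deriv m.
Proof. by rewrite dpoly_derivU UZ. Qed.

Let leibniz_alg (B : comAlgType A) (a b a' b' : A) (x y u v : B) :
  (a' * b + a * b') *: (x * y) + (a * b) *: (u * y + x * v) =
  (a' *: x + a *: u) * (b *: y) + (a *: x) * (b' *: y + b *: v).
Proof.
rewrite scalerDl scalerDr mulrDl mulrDr -!scalerAl -!scalerAr !scalerA.
by rewrite addrACA.
Qed.

Let distl_alg (B : pzRingType) (x y u v h k : B) :
  (x * h + u * k) + (y * h + v * k) = (x + y) * h + (u + v) * k.
Proof. by rewrite addrACA !mulrDl. Qed.

Let distr_alg (B : pzRingType) (x y u v h k : B) :
  (h * x + k * u) + (h * y + k * v) = h * (x + y) + k * (u + v).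
Proof. by rewrite addrACA !mulrDr. Qed.

Lemma dpoly_derivM f g :
  dpoly_deriv (f * g) = dpoly_deriv f * g + f * dpoly_deriv g.
Proof.
pose P f g := dpoly_deriv (f * g) = dpoly_deriv f * g + f * dpoly_deriv g.
have PU a m b k : P << a *g m >> << b *g k >>.
  have e1 := etrans (congr1 dpoly_deriv (monalgUM a b m k)) (DU _ _).
  have e2 := f_equal2 *%R (DU a m) (UZ b k).
  have e3 := f_equal2 *%R (UZ a m) (DU b k).
  apply: etrans e1 _; apply: etrans (esym (f_equal2 +%R e2 e3)).
  apply: etrans (f_equal2 +%R (congr1 (GRing.scale _) (UM m k))
    (congr1 (GRing.scale _) (dmonom_derivM m k))) _.
  rewrite deltaM.
  move: << m >> << k >> (dmonom_deriv m) (dmonom_deriv k) => x y u v.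
  exact: leibniz_alg.
have PDl f1 f2 h : P f1 h -> P f2 h -> P (f1 + f2) h.
  move=> P1 P2; apply: etrans (congr1 dpoly_deriv (mulrDl f1 f2 h)) _.
  apply: etrans (dpoly_derivD _ _) _; apply: etrans (f_equal2 +%R P1 P2) _.
  have e := congr1 (fun y => y * h + (f1 + f2) * dpoly_deriv h)
    (dpoly_derivD f1 f2).
  by apply: etrans (esym e); exact: distl_alg.
have PDr h f1 f2 : P h f1 -> P h f2 -> P h (f1 + f2).
  move=> P1 P2; apply: etrans (congr1 dpoly_deriv (mulrDr h f1 f2)) _.
  apply: etrans (dpoly_derivD _ _) _; apply: etrans (f_equal2 +%R P1 P2) _.
  have e := congr1 (fun y => dpoly_deriv h * (f1 + f2) + h * y)
    (dpoly_derivD f1 f2).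
  by apply: etrans (esym e); exact: distr_alg.
rewrite -/(P f g) [f]monalgE.
elim/big_ind: _ => [|f1 f2|m _]; last 1 first.
- rewrite [g]monalgE; elim/big_ind: _ => [|g1 g2|k _]; last exact: PU.
    by rewrite /P !mulr0 dpoly_deriv0 mulr0 addr0.
  exact: PDr.
- by rewrite /P !mul0r dpoly_deriv0 mul0r addr0.
- exact: PDl.
Qed.

Lemma dpoly_derivC a : dpoly_deriv a%:MP = (delta a)%:MP.
Proof.
by rewrite dpoly_derivU /dmonom_deriv mdom1 big_seq_fset0 scaler0 addr0.
Qed.

Lemma dpoly_deriv_var j : dpoly_deriv (dvar j) = dvar j.+1.
Proof.
rewrite dpoly_derivU /dmonom_deriv mdomU big_seq_fset1 scale1r cmUU.
have -> : delta 1 = 0.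
  by apply: (addrI (delta 1)); rewrite addr0 -{3}[1](mulr1 1) deltaM mulr1 mul1r.
rewrite [X in X + _]monalgU0 add0r; apply: (congr1 (mkmalgU ^~ _)).
apply/eqP/cmP => i.
by rewrite cmM divcmE subnn.
Qed.

End DifferentialPolynomials.

Section DifferentialIdeals.
Variables (S : comNzRingType) (d : S -> S).
Implicit Types f g : S.

Definition differential_ideal (I : set S) : Prop :=
  [/\ I 0,
      forall f g, I f -> I g -> I (f + g),
      forall f g, I g -> I (f * g)
    & forall f, I f -> I (d f)].

(* The smallest differential ideal containing f. *)
Definition diff_ideal f : set S :=
  [set g | forall I, differential_ideal I -> I f -> I g].

Hypothesis dD : forall f g, d (f + g) = d f + d g.
Hypothesis dM : forall f g, d (f * g) = d f * g + f * d g.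

Lemma diff_idealP f g :
  diff_ideal f g <->
  exists n (h : nat -> S), g = \sum_(i < n) h i * iter i d f.
Proof.
split=> [fg|[n [h ->]] I [I0 ID IM Id] If]; last first.
  elim/big_ind: _ => // i _; apply: (IM).
  by elim: (nat_of_ord i) => //= k; exact: Id.
pose J := [set g | exists n (h : nat -> S), g = \sum_(i < n) h i * iter i d f].
have J1 i h : J (h * iter i d f).
  exists i.+1, (fun k => if k == i then h else 0).
  rewrite big_ord_recr /= eqxx big1 ?add0r // => k _.
  by rewrite ltn_eqF ?mul0r.
have J0 : J 0 by exists 0%N, (fun=> 0); rewrite big_ord0.
have widen n m (h : nat -> S) : (n <= m)%N ->
    \sum_(i < n) h i * iter i d f =
    \sum_(i < m) (if (i < n)%N then h i else 0) * iter i d f.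
  move=> le_nm; rewrite (big_ord_widen m (fun i => h i * iter i d f) le_nm).
  rewrite big_mkcond /=; apply: eq_bigr => i _.
  by case: ifP => _; rewrite ?mul0r.
have JD x y : J x -> J y -> J (x + y).
  move=> [n [h ->]] [m [k ->]]; exists (maxn n m).
  exists (fun i => (if (i < n)%N then h i else 0) + (if (i < m)%N then k i else 0)).
  rewrite (widen _ _ _ (leq_maxl n m)) (widen _ _ _ (leq_maxr n m)) -big_split.
  by apply: eq_bigr => i _; rewrite mulrDl.
apply: (fg J); last by rewrite -[f]mul1r; exact: (J1 0%N).
have d0 : d 0 = 0 by apply: (addrI (d 0)); rewrite -dD !addr0.
split=> // [x y|x] [n [h ->]].
  rewrite mulr_sumr; elim/big_ind: _ => // i _.
  by rewrite mulrA; exact: J1.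
rewrite (big_morph d dD d0); elim/big_ind: _ => // i _.
by rewrite dM; apply: JD; [exact: J1 | exact: (J1 i.+1)].
Qed.

End DifferentialIdeals.

(* The derivation d of K[[t]]{x}. *)
Definition fps_dpoly_deriv (K : comNzRingType) :
    {dpoly (fps K)} -> {dpoly (fps K)} :=
  dpoly_deriv (@fps_deriv K).

Section FpsDpolyDeriv.
Variable K : comNzRingType.
Implicit Types f g : {dpoly (fps K)}.

Lemma fps_dpoly_derivD f g :
  fps_dpoly_deriv (f + g) = fps_dpoly_deriv f + fps_dpoly_deriv g.
Proof. exact: (dpoly_derivD (@fps_derivD K)). Qed.

Lemma fps_dpoly_derivM f g :
  fps_dpoly_deriv (f * g) = fps_dpoly_deriv f * g + f * fps_dpoly_deriv g.
Proof. exact: (dpoly_derivM (@fps_derivD K) (@fps_derivM K)). Qed.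

Lemma fps_dpoly_derivC (a : fps K) :
  fps_dpoly_deriv a%:MP = (fps_deriv a)%:MP.
Proof. exact: (dpoly_derivC (@fps_derivD K)). Qed.

Lemma fps_dpoly_deriv_var j : fps_dpoly_deriv (dvar (fps K) j) = dvar (fps K) j.+1.
Proof. exact: (dpoly_deriv_var (@fps_derivD K) (@fps_derivM K)). Qed.

End FpsDpolyDeriv.

Section Tropicalization.
Variables (R : realType) (K : fieldType) (nu : K -> trop R).

(* [leading val a] is (m, val (a m)) for the smallest m with a m != 0, and oo
   if a = 0.  It yields both v on K[[t]] (with val = nu) and w on T[[t]] (with
   val the identity; there [a m != 0] means that the coefficient is not oo). *)
Definition leading (A : nmodType) (val : A -> trop R) (a : fps A) : trop2 R :=
  match pselect (exists i, a i != 0) with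
  | left ex_i => let m := ex_minn ex_i in omap (pair m%:R) (val (a m))
  | right _ => 0
  end.

Definition vlead : fps K -> trop2 R := leading nu.

Definition wlead : fps (trop R) -> trop2 R := leading id.

Definition tropical_poly : Type := {fsfun {cmonom nat} -> trop2 R with 0}.

Definition trop_poly (f : {dpoly (fps K)}) : tropical_poly :=
  [fsfun m in msupp f => vlead f@_m | 0].

Definition trop_deriv (B : fps (trop R)) : fps (trop R) :=
  Fps (fun n => nu n.+1%:R * B n.+1).

Definition term_eval (f : tropical_poly) (B : fps (trop R)) (m : {cmonom nat}) :
    trop2 R :=
  f m * \prod_(j <- finsupp m) wlead (iter j trop_deriv B) ^+ m j.

Definition trop_eval (f : tropical_poly) (B : fps (trop R)) : trop2 R :=
  \sum_(m <- finsupp f) term_eval f B m.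

(* The terms of f are those with a finite coefficient; as usual, a minimum equal
   to oo counts as being attained at least twice, so that every B is a solution
   of the polynomial oo = trop(0) and B = oo is a solution of any f without
   constant term. *)
Definition tropical_solution (f : tropical_poly) (B : fps (trop R)) : Prop :=
  trop_eval f B = 0 \/
  exists m1 m2, [/\ m1 \in finsupp f, m2 \in finsupp f, m1 != m2,
    term_eval f B m1 = trop_eval f B & term_eval f B m2 = trop_eval f B].

Definition Sol (f : tropical_poly) : set (fps (trop R)) :=
  [set B | tropical_solution f B].

Definition differential_tropical_basis (F : set {dpoly (fps K)})
    (I : set {dpoly (fps K)}) : Prop :=
  F `<=` I /\
  \bigcap_(f in trop_poly @` I) Sol f =
  \bigcap_(f in F) \bigcap_n Sol (trop_poly (iter n (@fps_dpoly_deriv K) f)).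

End Tropicalization.

(* (K, nu) is C_p with its p-adic valuation: K is complete, Q_p is the closure
   of Q in K, and the elements of K that are algebraic over Q_p form an
   algebraically closed field which is dense in K.  In other words, K is a
   completion of an algebraic closure of Q_p, and this determines (K, nu) up to
   isomorphism.  The characteristic of K is 0 because nu p = 1. *)
Section PadicComplexNumbers.
Variables (R : realType) (p : nat) (K : fieldType) (nu : K -> trop R).

Definition valuation : Prop :=
  [/\ forall x, nu x = 0 <-> x = 0,
      forall x y, nu (x * y) = nu x * nu y
    & forall x y, trop_le (nu x + nu y) (nu (x + y))].

Definition Qp : set K :=
  [set x | forall r : R, exists q : rat, trop_le (Some r) (nu (x - ratr q))].

Definition Qp_algebraic : set K :=
  [set x | exists P : {poly K}, [/\ P != 0, forall i, Qp P`_i & root P x]].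

Definition nu_cauchy (u : nat -> K) : Prop :=
  forall r : R, exists N : nat, forall m n : nat, (N <= m)%N -> (N <= n)%N ->
    trop_le (Some r) (nu (u m - u n)).

Definition nu_cvg (u : nat -> K) (l : K) : Prop :=
  forall r : R, exists N : nat, forall n : nat, (N <= n)%N ->
    trop_le (Some r) (nu (u n - l)).

Record padic_complex_numbers : Prop := PadicComplexNumbers {
  Cp_valuation : valuation;
  Cp_val_p : nu p%:R = Some 1;
  Cp_complete : forall u, nu_cauchy u -> exists l, nu_cvg u l;
  Cp_alg_closed : forall P : {poly K}, (1 < size P)%N ->
    (forall i, Qp_algebraic P`_i) -> exists2 x, Qp_algebraic x & root P x;
  Cp_dense : forall x (r : R), exists2 y, Qp_algebraic y &
    trop_le (Some r) (nu (x - y))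
}.

End PadicComplexNumbers.

(* Main.v *)
Require Import Defs.
From HB Require Import structures.
From mathcomp Require Import all_boot all_order all_algebra finmap.
From mathcomp Require Import boolp classical_sets reals.
From mathcomp Require Import monalg.
From mathcomp Require Import ring.

Set Implicit Arguments.
Unset Strict Implicit.
Unset Printing Implicit Defensive.

Import Order.TTheory GRing.Theory Num.Theory.

Local Open Scope classical_set_scope.
Local Open Scope ring_scope.

(** One inclusion is formal, because every derivative of F lies in [F].  For
    the other one, let B be a tropical solution of all the trop(d^n F) and let
    b_n be the constant coefficient of its n-th tropical derivative, which is
    nu(n!) + B_n.  The idea is to lift B to a genuine solution
    y = sum_n (u_n / n!) t^n of F with nu(y_n) = B_n.  Once this is done, every
    f in [F] vanishes at y, and a vanishing sum of elements of a valued ring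
    attains its least valuation twice, so that B solves trop(f)
    ([tval_vanishes], [lifted_solution]).

    Two points make the lift possible.

    Write a = nu(al1) < b = nu(al2); the assertion is symmetric in al1 and al2.
    Comparing the terms of trop(d^n F) of t-order 0 shows that the minimum of
    b_(n+2), a + b_(n+1), a + b + b_n is attained twice for every n
    ([solution_vanishes_at0]).  Let N be the first index where b_(n+1) differs
    from b + b_n.  From N on the inequality persists ([break_persists]), so the
    last two of the three terms differ and their minimum determines b_(n+2).
    Before N the sequence b_n is arithmetic with difference b (if there is no
    N, a multiple of al2^n is the lift).  A solution of
    u_(n+2) = (al1 + al2) u_(n+1) - al1 al2 u_n with nu(u_N) = b_N and
    nu(u_(N+1)) = b_(N+1) has therefore the right valuations after N, and also
    before N, provided that (al1 + al2) u_N and u_(N+1) do not cancel in the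
    step that yields u_(N-1).  Their valuations may coincide; in all other
    steps the two valuations differ.

    The b_n are arbitrary reals, whereas the valuations of K may not be, so u_N
    and u_(N+1) are taken in a larger valued ring.  Two independent
    indeterminates with prescribed values, with the Gauss valuation on iterated
    polynomial rings, realise every pair of values and rule out the
    cancellation at N ([gaussM], [adjoin_two_values], [lift_recurrence]).

    The arguments on T and T^(2) use only that addition is selective and
    multiplication cancellative, so they are carried out for all such
    semirings. *)

(** * Semirings with selective addition and cancellative multiplication *)

(** The common abstraction of T and T^(2): the sum is a minimum for a total
    order, and the product is the sum of an ordered cancellative monoid. *)
Record tropical_semiring (T : comNzSemiRingType) : Prop := TropicalSemiring {
  trop_selective : forall x y : T, x + y = x \/ x + y = y;
  trop_cancel : forall z x y : T, z != 0 -> z * x = z * y -> x = y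
}.

(** In min-convention, x + y = x means that x is the smaller one; 0 is the
    largest element. *)
Definition trle (T : comNzSemiRingType) (x y : T) : Prop := x + y = x.

Section TropicalSemiringTheory.
Variables (T : comNzSemiRingType) (hT : tropical_semiring T).
Implicit Types x y z : T.

Lemma trop_addxx x : x + x = x.
Proof. by case: (trop_selective hT x x). Qed.

Lemma trop_mul_eq0 x y : x * y = 0 -> x = 0 \/ y = 0.
Proof.
have [->|x0] := eqVneq x 0; first by left.
by move=> xy; right; apply: (trop_cancel hT x0); rewrite mulr0.
Qed.

Lemma trop_mul_neq0 x y : x != 0 -> y != 0 -> x * y != 0.
Proof.
by move=> x0 y0; apply/eqP => /trop_mul_eq0[]; apply/eqP.
Qed.

Lemma trop_exp_neq0 x n : x != 0 -> x ^+ n != 0.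
Proof.
move=> x0; elim: n => [|n IH]; rewrite ?expr0 ?oner_eq0 // exprS.
exact: trop_mul_neq0.
Qed.

Lemma trle_refl x : trle x x. Proof. exact: trop_addxx. Qed.

Lemma trle_anti x y : trle x y -> trle y x -> x = y.
Proof. by rewrite /trle => xy yx; rewrite -xy addrC. Qed.

Lemma trle_trans y x z : trle x y -> trle y z -> trle x z.
Proof. by rewrite /trle => xy yz; rewrite -{1}xy -addrA yz. Qed.

Lemma trle_addr x y z : trle x y -> trle x z -> trle x (y + z).
Proof. by rewrite /trle addrA => -> ->. Qed.

Lemma trle_mul x y z : trle x y -> trle (z * x) (z * y).
Proof. by rewrite /trle -mulrDr => ->. Qed.

Lemma trle_mul2 x1 x2 y1 y2 :
  trle x1 y1 -> trle x2 y2 -> trle (x1 * x2) (y1 * y2).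
Proof.
move=> h1 h2; apply: (@trle_trans (x1 * y2)); first exact: trle_mul.
by rewrite [x1 * _]mulrC [y1 * _]mulrC; exact: trle_mul.
Qed.

Lemma trle_cancel z x y : z != 0 -> trle (z * x) (z * y) -> trle x y.
Proof. by move=> z0; rewrite /trle -mulrDr; exact: trop_cancel. Qed.

Lemma trle_sum (I : Type) (s : seq I) (P : pred I) (F : I -> T) x :
  (forall i, P i -> trle x (F i)) -> trle x (\sum_(i <- s | P i) F i).
Proof.
move=> h; elim/big_ind: _ => //; first exact: addr0.
by move=> y z; exact: trle_addr.
Qed.

Lemma trle_sum_term (I : eqType) (s : seq I) (P : pred I) (F : I -> T) i :
  i \in s -> P i -> trle (\sum_(j <- s | P j) F j) (F i).
Proof.
move=> si Pi; rewrite /trle; elim: s si => // a s IH; rewrite inE big_cons.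
case/predU1P => [<-|/IH e]; first by rewrite Pi addrAC trop_addxx.
by case: ifP => _; rewrite -?addrA e.
Qed.

(** Equality in a product of two inequalities forces equality in both, by
    cancellation. *)
Lemma trle_mul2_eq a b x y : a * b != 0 -> trle a x -> trle b y ->
  x * y = a * b -> x = a /\ y = b.
Proof.
move=> ab ax byy e.
have a0 : a != 0 by apply: contraNneq ab => ->; rewrite mul0r.
have b0 : b != 0 by apply: contraNneq ab => ->; rewrite mulr0.
split.
  apply: (trop_cancel hT b0); apply: trle_anti; last exact: trle_mul.
  by rewrite [b * a]mulrC -e mulrC; apply: trle_mul.
apply: (trop_cancel hT a0); apply: trle_anti; last exact: trle_mul.
by rewrite -e ![_ * y]mulrC; apply: trle_mul.
Qed.

Lemma trop_sum_attained (I : eqType) (s : seq I) (P : pred I) (F : I -> T) :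
  \sum_(i <- s | P i) F i != 0 ->
  exists2 i, (i \in s) && P i & F i = \sum_(j <- s | P j) F j.
Proof.
elim: s => [|i s IH]; first by rewrite big_nil eqxx.
rewrite big_cons; case: ifP => Pi; last first.
  by move=> /IH[j /andP[js Pj] e]; exists j; rewrite // inE js orbT.
case: (trop_selective hT (F i) (\sum_(j <- s | P j) F j)) => ->.
  by exists i; rewrite ?inE ?eqxx.
by move=> /IH[j /andP[js Pj] e]; exists j; rewrite // inE js orbT.
Qed.

(** A minimum of three terms that is attained twice (each pair of terms having
    the same minimum) determines the first term as soon as the two others
    differ. *)
Lemma trop3_distinct x y z : x + y = y + z -> x + z = y + z -> y <> z ->
  x = y + z.
Proof.
move=> xy xz yz; case: (trop_selective hT y z) => e; rewrite e in xy xz *.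
  by case: (trop_selective hT x z); rewrite xz => h; last case: yz.
by case: (trop_selective hT x y); rewrite xy => h; last case: yz.
Qed.

(** The minimum is attained at least twice, in the form: deleting any one term
    does not change it.  This covers the case where all terms are infinite, and
    is preserved by adding infinite terms. *)
Definition tropically_vanishes (I : eqType) (s : seq I) (F : I -> T) : Prop :=
  {in s, forall i, \sum_(j <- s | j != i) F j = \sum_(j <- s) F j}.

Lemma vanishes_attained_twice (I : eqType) (s : seq I) (F : I -> T) :
  tropically_vanishes s F ->
  \sum_(i <- s) F i = 0 \/
  exists i j, [/\ i \in s, j \in s, i != j,
    F i = \sum_(k <- s) F k & F j = \sum_(k <- s) F k].
Proof.
move=> van; have [->|s0] := eqVneq (\sum_(i <- s) F i) 0; [by left|right].
have [i] := trop_sum_attained s0; rewrite andbT => si ei.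
have := s0; rewrite -(van i si) => /trop_sum_attained[j /andP[sj ji] ej].
by exists i, j; rewrite sj si eq_sym ji ej van.
Qed.

Lemma attained_twice_vanishes (I : eqType) (s : seq I) (F : I -> T) i j :
  i \in s -> j \in s -> i != j ->
  F i = \sum_(k <- s) F k -> F j = \sum_(k <- s) F k ->
  tropically_vanishes s F.
Proof.
have H i' k : i' \in s -> F i' = \sum_(k <- s) F k -> i' != k ->
   \sum_(j <- s | j != k) F j = \sum_(j <- s) F j.
  move=> si ei ik; apply: trle_anti; first by rewrite -ei; exact: trle_sum_term.
  rewrite [X in trle _ X]big_seq_cond; apply: trle_sum => l /andP[sl _].
  exact: trle_sum_term.
move=> si sj ij ei ej k sk; have [ik|ik] := eqVneq i k; last exact: (H i).
by apply: (H j) => //; rewrite -ik eq_sym.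
Qed.

End TropicalSemiringTheory.

(** * Valuations and the Gauss valuation *)

Record tropical_valuation (T : comNzSemiRingType) (A : comNzRingType)
    (v : A -> T) : Prop := TropicalValuation {
  tval_eq0 : forall x, v x = 0 <-> x = 0;
  tvalM : forall x y, v (x * y) = v x * v y;
  tvalD : forall x y, trle (v x + v y) (v (x + y))
}.

Section ValuationTheory.
Variables (T : comNzSemiRingType) (hT : tropical_semiring T).
Variables (A : comNzRingType) (v : A -> T) (hv : tropical_valuation v).
Implicit Types x y z : A.

Lemma tval0 : v 0 = 0. Proof. by apply/(tval_eq0 hv). Qed.

Lemma tval_neq0 x : x != 0 -> v x != 0.
Proof. by apply: contra_neq => /(tval_eq0 hv). Qed.

Lemma tval1 : v 1 = 1.
Proof.
have v1 : v 1 != 0 by apply: tval_neq0; exact: oner_neq0.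
by apply: (trop_cancel hT v1); rewrite -(tvalM hv) !mulr1.
Qed.

(** The only square root of 1 is 1, because x + 1 is x or 1, and multiplying
    either equation by x gives the other one. *)
Lemma tvalN1 : v (-1) = 1.
Proof.
have e : v (-1) * v (-1) = 1 by rewrite -(tvalM hv) mulrNN mulr1 tval1.
case: (trop_selective hT (v (-1)) 1) => h; last first.
  have := congr1 ( *%R (v (-1))) h; rewrite mulrDr e mulr1 addrC h => ->.
  by [].
by have := congr1 ( *%R (v (-1))) h; rewrite mulrDr e mulr1 addrC h.
Qed.

Lemma tvalN x : v (- x) = v x.
Proof. by rewrite -mulN1r (tvalM hv) tvalN1 mul1r. Qed.

Lemma tvalX x n : v (x ^+ n) = v x ^+ n.
Proof.
by elim: n => [|n IH]; rewrite ?expr0 ?tval1 // !exprS (tvalM hv) IH.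
Qed.

Lemma tval_prod (I : Type) (s : seq I) (F : I -> A) :
  v (\prod_(i <- s) F i) = \prod_(i <- s) v (F i).
Proof. exact: (big_morph v (tvalM hv) tval1). Qed.

Lemma tval_sum (I : Type) (s : seq I) (P : pred I) (F : I -> A) :
  trle (\sum_(i <- s | P i) v (F i)) (v (\sum_(i <- s | P i) F i)).
Proof.
elim: s => [|i s IH]; first by rewrite !big_nil /trle tval0 addr0.
rewrite !big_cons; case: ifP => // _; apply: (trle_trans _ (tvalD hv _ _)).
by rewrite /trle addrACA (trop_addxx hT) IH.
Qed.

(** Each term is minus the sum of the others, so its value is at least the
    minimum of the other values. *)
Lemma tval_vanishes (I : eqType) (s : seq I) (F : I -> A) : uniq s ->
  \sum_(i <- s) F i = 0 -> tropically_vanishes s (v \o F).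
Proof.
move=> us s0 i si; rewrite [RHS](bigD1_seq i) //= addrC.
have : F i = - \sum_(j <- s | j != i) F j.
  by apply/eqP; rewrite -addr_eq0 -(bigD1_seq i) //= s0.
by move=> /(congr1 v); rewrite tvalN => ->; rewrite tval_sum.
Qed.

Lemma tvalD_distinct x y : v x <> v y -> v (x + y) = v x + v y.
Proof.
have H a b : v (a + b) + v b = v a + v b.
  have := tvalD hv (a + b) (- b); rewrite addrK tvalN => <-.
  by rewrite -addrA addrC [v b + v a]addrC (tvalD hv).
by apply: (trop3_distinct hT); rewrite ?H // [x + y]addrC H addrC.
Qed.

End ValuationTheory.

Section Gauss.
Variables (T : comNzSemiRingType) (hT : tropical_semiring T).
Variables (A : comNzRingType) (v : A -> T) (hv : tropical_valuation v).
Variables (c : T) (c0 : c != 0).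
Implicit Types P Q : {poly A}.

(** The valuation on A[X] that extends v and gives X the value c without
    allowing any cancellation between different powers of X. *)
Definition gauss P : T := \sum_(i < size P) v P`_i * c ^+ i.

Lemma gauss_le P i : trle (gauss P) (v P`_i * c ^+ i).
Proof.
have [iP|Pi] := ltnP i (size P); last first.
  by rewrite nth_default // (tval0 hv) mul0r /trle addr0.
exact: (trle_sum_term hT (fun j : 'I_(size P) => v P`_j * c ^+ j)
  (mem_index_enum (Ordinal iP))).
Qed.

Lemma gauss_glb P x : (forall i, trle x (v P`_i * c ^+ i)) -> trle x (gauss P).
Proof. by move=> h; apply: trle_sum => i _. Qed.

Lemma gaussE n P : (size P <= n)%N -> gauss P = \sum_(i < n) v P`_i * c ^+ i.
Proof.
move=> Pn; apply: trle_anti.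
  by apply: trle_sum => i _; exact: gauss_le.
apply: gauss_glb => i; have [iP|Pi] := ltnP i (size P); last first.
  by rewrite nth_default // (tval0 hv) mul0r /trle addr0.
exact: (trle_sum_term hT (fun j : 'I_n => v P`_j * c ^+ j)
  (mem_index_enum (Ordinal (leq_trans iP Pn)))).
Qed.

Lemma gauss_eq0 P : gauss P = 0 <-> P = 0.
Proof.
split=> [g0|->]; last by rewrite /gauss size_poly0 big_ord0.
apply/polyP => i; rewrite coef0; apply/(tval_eq0 hv).
have := gauss_le P i; rewrite g0 /trle add0r.
case/(trop_mul_eq0 hT) => // /eqP; apply: contraTeq => _.
exact: trop_exp_neq0.
Qed.

Lemma gaussD P Q : trle (gauss P + gauss Q) (gauss (P + Q)).
Proof.
apply: gauss_glb => i; rewrite coefD.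
apply: (trle_trans (y := (v P`_i + v Q`_i) * c ^+ i)); last first.
  by rewrite ![_ * c ^+ i]mulrC; apply: trle_mul; exact: tvalD.
by rewrite mulrDl /trle addrACA !gauss_le.
Qed.

(** The first index where the minimum is attained. *)
Definition gauss_index P i : Prop :=
  v P`_i * c ^+ i = gauss P /\
  forall j, v P`_j * c ^+ j = gauss P -> (i <= j)%N.

Lemma gauss_indexP P : P != 0 -> exists i, gauss_index P i.
Proof.
move=> P0; have g0 : gauss P != 0 by apply: contra_neq P0 => /gauss_eq0.
have ex : exists i, v P`_i * c ^+ i == gauss P.
  by have [i _ e] := trop_sum_attained hT g0; exists i; rewrite e.
exists (ex_minn ex); case: ex_minnP => i /eqP ei min_i.
by split=> // j /eqP; exact: min_i.
Qed.

Lemma gaussM_le P Q : trle (gauss P * gauss Q) (gauss (P * Q)).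
Proof.
apply: gauss_glb => k; rewrite coefM.
apply: (@trle_trans _ (\sum_(j < k.+1) v (P`_j * Q`_(k - j)) * c ^+ k)).
  apply: trle_sum => j _; rewrite (tvalM hv).
  rewrite -[X in c ^+ X](subnKC (leq_ord j)) exprD mulrACA.
  by apply: trle_mul2; exact: gauss_le.
by rewrite -mulr_suml ![_ * c ^+ k]mulrC; apply: trle_mul; exact: tval_sum.
Qed.

(** If i and j are the first indices where P and Q attain their minima, then in
    the coefficient of X^(i + j) of P Q the product of the i-th and j-th
    coefficients has strictly smaller value than all other terms. *)
Lemma gaussM P Q : gauss (P * Q) = gauss P * gauss Q.
Proof.
have [->|P0] := eqVneq P 0; first by rewrite mul0r (gauss_eq0 0).2 // mul0r.
have [->|Q0] := eqVneq Q 0; first by rewrite mulr0 (gauss_eq0 0).2 // mulr0.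
have gP : gauss P != 0 by apply: contra_neq P0 => /gauss_eq0.
have gQ : gauss Q != 0 by apply: contra_neq Q0 => /gauss_eq0.
apply: trle_anti; last exact: gaussM_le.
have [i [ei min_i]] := gauss_indexP P0; have [j [ej min_j]] := gauss_indexP Q0.
pose k := (i + j)%N; have ck0 : c ^+ k != 0 by exact: trop_exp_neq0.
have ik : (i < k.+1)%N by rewrite ltnS leq_addr.
pose z (l : 'I_k.+1) := P`_l * Q`_(k - l).
have vz l :
    v (z l) * c ^+ k = (v P`_l * c ^+ l) * (v Q`_(k - l) * c ^+ (k - l)).
  by rewrite (tvalM hv) mulrACA -exprD subnKC // leq_ord.
have gPQ_z l : trle (gauss P * gauss Q) (v (z l) * c ^+ k).
  by rewrite vz; apply: trle_mul2; exact: gauss_le.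
have zi : v (z (Ordinal ik)) * c ^+ k = gauss P * gauss Q.
  by rewrite vz /= ei /k addKn ej.
have zi_le l : trle (v (z (Ordinal ik))) (v (z l)).
  by apply: (trle_cancel hT ck0); rewrite ![c ^+ k * _]mulrC zi.
pose s := \sum_(l < k.+1 | l != Ordinal ik) z l.
have le_s : trle (\sum_(l < k.+1 | l != Ordinal ik) v (z l)) (v s).
  exact: tval_sum.
have zi_s : trle (v (z (Ordinal ik))) (v s).
  by apply: trle_trans le_s; apply: trle_sum.
(* equality would make another term of the convolution minimal, hence both its
   factors minimal, against the choice of i and j *)
have ne : v (z (Ordinal ik)) <> v s.
  move=> e; have e2 : \sum_(l < k.+1 | l != Ordinal ik) v (z l) = v s.
    by apply: trle_anti => //; rewrite -e; apply: trle_sum.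
  have : \sum_(l < k.+1 | l != Ordinal ik) v (z l) != 0.
    rewrite e2 -e; apply: contraTneq (trop_mul_neq0 hT gP gQ) => z0.
    by rewrite -zi z0 mul0r eqxx.
  case/(trop_sum_attained hT) => l /andP[_ li]; rewrite e2 -e => el.
  have := zi; rewrite -el vz.
  case/(trle_mul2_eq hT (trop_mul_neq0 hT gP gQ) (gauss_le _ _) (gauss_le _ _)).
  move=> /min_i il /min_j jl; case/eqP: li; apply: val_inj => /=.
  apply/eqP; rewrite eqn_leq il andbT.
  rewrite -(leq_add2r j) (leq_trans (leq_add (leqnn l) jl)) // subnKC //.
  exact: leq_ord.
have := gauss_le (P * Q) k; rewrite coefM (bigD1 (Ordinal ik)) //=.
rewrite -[\sum_(_ | _) _]/s -[P`_i * _]/(z (Ordinal ik)).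
by rewrite (tvalD_distinct hT hv ne) zi_s zi.
Qed.

Lemma gauss_valuation : tropical_valuation gauss.
Proof. by split; [exact: gauss_eq0 | exact: gaussM | exact: gaussD]. Qed.

Lemma gaussC x : gauss x%:P = v x.
Proof.
rewrite (@gaussE 1%N) ?size_polyC_leq1 // big_ord1 coefC eqxx expr0 mulr1 //.
Qed.

Lemma gauss_linear x y : gauss (x%:P + y%:P * 'X) = v x + v y * c.
Proof.
rewrite (@gaussE 2%N) ?big_ord_recl ?big_ord0 /=; last first.
  by rewrite addrC size_MXaddC; case: ifP => // _; rewrite ltnS size_polyC_leq1.
by rewrite !coefD !coefCM !coefX !coefC /= mulr0 mulr1 addr0 add0r !mulr1 addr0.
Qed.

End Gauss.

(** Two elements of prescribed, possibly infinite, values, such that no linear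
    combination of them over A has a cancellation. *)
Lemma adjoin_two_values (T : comNzSemiRingType) (hT : tropical_semiring T)
    (A : comNzRingType) (v : A -> T) (hv : tropical_valuation v) (r1 r2 : T) :
  exists (L : comNzRingType) (iota : {rmorphism A -> L}) (mu : L -> T)
      (y1 y2 : L),
    [/\ tropical_valuation mu, forall k, mu (iota k) = v k &
      forall k1 k2, mu (iota k1 * y1 + iota k2 * y2) = v k1 * r1 + v k2 * r2].
Proof.
(* an infinite value r = 0 is realised by the element 0, and the indeterminate
   then gets the finite value 1 to keep the Gauss valuation nondegenerate *)
pose c r : T := if r == 0 then 1 else r.
have c0 r : c r != 0.
  by rewrite /c; case: (eqVneq r 0) => [_|//]; rewrite oner_eq0.
pose X (B : comNzRingType) (r : T) : {poly B} := if r == 0 then 0 else 'X.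
have lin (B : comNzRingType) (w : B -> T) (hw : tropical_valuation w) r x k :
    gauss w (c r) (x%:P + k%:P * X B r) = w x + w k * r.
  rewrite /c /X; case: eqVneq => [->|r0]; last exact: gauss_linear.
  by rewrite !mulr0 !addr0 gaussC.
pose mu1 := gauss v (c r1).
have hmu1 : tropical_valuation mu1 by exact: gauss_valuation.
pose mu2 := gauss mu1 (c r2).
have hmu2 : tropical_valuation mu2 by exact: gauss_valuation.
exists ({poly {poly A}} : comNzRingType), (polyC \o polyC), mu2,
  (X A r1)%:P, (X {poly A} r2); split=> //= [k|k1 k2].
  by rewrite /mu2 gaussC // /mu1 gaussC.
rewrite -polyCM /mu2 lin // -[_ * X A r1]add0r /mu1.
have -> : 0 = 0%:P :> {poly A} by [].
by rewrite lin // gaussC // (tval0 hv) add0r.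
Qed.

(** * Tropical linear recurrences of order two and their lifts *)

Section LiftRecurrence.
Variables (T : comNzSemiRingType) (hT : tropical_semiring T).
Variables (a b : T) (ab : trle a b) (neq_ab : a <> b) (beta : nat -> T).

(* the minimum of beta n.+2, a * beta n.+1, a * b * beta n is attained twice *)
Hypothesis beta_vanishes : forall n,
  beta n.+2 + a * beta n.+1 = a * beta n.+1 + a * b * beta n /\
  beta n.+2 + a * b * beta n = a * beta n.+1 + a * b * beta n.

Let a_neq0 : a != 0.
Proof.
by apply: contra_notN neq_ab => /eqP a0; move: ab; rewrite a0 /trle add0r.
Qed.

(** If beta n.+2 were b * beta n.+1, then a * beta n.+1 would be strictly
    smaller, so the minimum would be shared by a * beta n.+1 and
    a * b * beta n, and a could be cancelled. *)
Lemma break_persists n : beta n.+1 <> b * beta n -> beta n.+2 <> b * beta n.+1.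
Proof.
move=> bn e; have [] := beta_vanishes n; rewrite e -mulrDl [b + a]addrC ab.
set Y := a * beta n.+1; set Z := a * b * beta n => YZ.
rewrite -YZ; case: (trop_selective hT (b * beta n.+1) Z) => ->.
  move=> bY; have b10 : beta n.+1 = 0.
    apply: contrapT => /eqP b10; apply: neq_ab; apply: (trop_cancel hT b10).
    by rewrite !(mulrC (beta _)) bY.
  have : Z = 0 by have := YZ; rewrite /Y b10 mulr0 add0r.
  rewrite /Z -mulrA => /(trop_mul_eq0 hT)[/eqP|bn0].
    by rewrite (negPf a_neq0).
  by rewrite bn0 in bn.
by rewrite /Y /Z -mulrA => /(trop_cancel hT a_neq0) /esym.
Qed.

Lemma break_next n : beta n.+1 <> b * beta n ->
  beta n.+2 = a * beta n.+1 + a * b * beta n.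
Proof.
move=> bn; have [h1 h2] := beta_vanishes n.
by apply: (trop3_distinct hT) => //; rewrite -mulrA => /(trop_cancel hT a_neq0).
Qed.

(** A change of slope can only occur where everything is finite: two
    consecutive infinite values force all later ones to be infinite. *)
Lemma break_base n : beta n.+1 = b * beta n -> beta n.+2 <> b * beta n.+1 ->
  b != 0 /\ beta n.+1 != 0.
Proof.
move=> e ne; suff b10 : beta n.+1 != 0.
  by split=> //; apply: contraNneq b10 => b0; rewrite e b0 mul0r.
apply/eqP => b10; case: ne; rewrite b10 mulr0.
have [] := beta_vanishes n; rewrite b10 -mulrA -e b10 !mulr0 !addr0.
by [].
Qed.

Lemma before_break n : beta n.+1 = b * beta n ->
  a * beta n.+1 + beta n.+2 = a * b * beta n.
Proof.
move=> e; have [] := beta_vanishes n.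
by rewrite -[a * b * _]mulrA -e addrC (trop_addxx hT).
Qed.

End LiftRecurrence.

(** The solution u is a combination of the powers of al1 and al2, normalised by
    its values at N and N.+1, where N is the first change of slope of beta. *)
Lemma lift_recurrence (T : comNzSemiRingType) (hT : tropical_semiring T)
    (K : fieldType) (nu : K -> T) (hnu : tropical_valuation nu)
    (al1 al2 : K) (beta : nat -> T) :
  trle (nu al1) (nu al2) -> nu al1 <> nu al2 ->
  (forall n,
    beta n.+2 + nu al1 * beta n.+1 =
      nu al1 * beta n.+1 + nu al1 * nu al2 * beta n /\
    beta n.+2 + nu al1 * nu al2 * beta n =
      nu al1 * beta n.+1 + nu al1 * nu al2 * beta n) ->
  exists (L : comNzRingType) (iota : {rmorphism K -> L}) (mu : L -> T)
      (u : nat -> L),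
    [/\ tropical_valuation mu, forall k, mu (iota k) = nu k,
      forall n, u n.+2 = iota (al1 + al2) * u n.+1 - iota (al1 * al2) * u n &
      forall n, mu (u n) = beta n].
Proof.
move=> ab neq_ab van; pose a := nu al1; pose b := nu al2.
have nuD : nu (al1 + al2) = a by rewrite (tvalD_distinct hT hnu).
have nuM : nu (al1 * al2) = a * b by rewrite (tvalM hnu).
have a0 : a != 0.
  by apply: contra_notN neq_ab => /eqP a0; move: ab; rewrite -/a a0 /trle add0r.
(* constant slope b: a multiple of the powers of al2 *)
have [geo|] := pselect (forall n, beta n.+1 = b * beta n).
  have [L [io [mu [y [y2 [hmu mu_io mu_y]]]]]] :=
    adjoin_two_values hT hnu (beta 0) 0.
  exists L, io, mu, (fun n => io (al2 ^+ n) * y); split=> // [n|n].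
    by rewrite !exprS !rmorphM rmorphD; ring.
  have := mu_y (al2 ^+ n) 0; rewrite rmorph0 mul0r mulr0 !addr0 => ->.
  rewrite (tvalX hT hnu) -/b.
  by elim: n => [|n IH]; rewrite ?expr0 ?mul1r // geo -IH exprS mulrA.
move/existsNP => exN.
have ex : exists n, `[< beta n.+1 <> b * beta n >].
  by have [n hn] := exN; exists n; apply/asboolP.
case: (ex_minnP ex) => N /asboolP brkN minN {exN ex}.
have geo n : (n < N)%N -> beta n.+1 = b * beta n.
  move=> nN; apply: contrapT => /asboolP /minN; by rewrite leqNgt nN.
have brk n : beta (N + n).+1 <> b * beta (N + n)%N.
  by elim: n => [|n IH]; rewrite ?addn0 // addnS; apply: (break_persists hT ab).
have geo_break : (0 < N)%N -> b != 0 /\ beta N != 0.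
  move=> N0; have := break_base van (n := N.-1); rewrite prednK //.
  apply; first by have := geo N.-1; rewrite prednK //; apply.
  by have := brk 0%N; rewrite addn0.
have al10 : al1 != 0 by apply: contraNneq a0 => z; rewrite /a z (tval0 hnu).
have al1N : al1 ^+ N != 0 by rewrite expf_neq0.
have al2N : al2 ^+ N != 0.
  have [->|/geo_break[b0 _]] := posnP N; first by rewrite expr0 oner_neq0.
  by rewrite expf_neq0 //; apply: contraNneq b0 => z; rewrite /b z (tval0 hnu).
have den0 : al1 - al2 != 0.
  by rewrite subr_eq0; apply: contra_notN neq_ab => /eqP ->.
have [L [io [mu [y1 [y2 [hmu mu_io mu_y]]]]]] :=
  adjoin_two_values hT hnu (beta N) (beta N.+1).
have muN x : mu (- x) = mu x by exact: (tvalN hT hmu).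
have mu1 : mu y1 = beta N.
  have := mu_y 1 0; rewrite rmorph1 rmorph0 mul1r mul0r addr0 => ->.
  by rewrite (tval1 hT hnu) (tval0 hnu) mul1r mul0r addr0.
have mu2 : mu y2 = beta N.+1.
  have := mu_y 0 1; rewrite rmorph1 rmorph0 mul1r mul0r add0r => ->.
  by rewrite (tval1 hT hnu) (tval0 hnu) mul1r mul0r add0r.
have mu12 : mu (io (al1 + al2) * y1 - y2) = a * beta N + beta N.+1.
  have := mu_y (al1 + al2) (-1); rewrite rmorphN1 mulN1r => ->.
  by rewrite (tvalN1 hT hnu) mul1r nuD.
(* c1 and c2 solve the linear system u N = y1, u N.+1 = y2; if al2 = 0 then
   N = 0, so that al2 ^+ N is invertible *)
pose d := io (al1 - al2)^-1.
have dP : d * (io al1 - io al2) = 1.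
  by rewrite /d -rmorphB -rmorphM mulVf // rmorph1.
pose c1 := io (al1 ^+ N * (al1 - al2))^-1 * (y2 - io al2 * y1).
pose c2 := io (al2 ^+ N * (al1 - al2))^-1 * (io al1 * y1 - y2).
have c1N : io (al1 ^+ N) * c1 = d * (y2 - io al2 * y1).
  by rewrite /c1 mulrA -rmorphM invfM mulrA mulfV // mul1r.
have c2N : io (al2 ^+ N) * c2 = d * (io al1 * y1 - y2).
  by rewrite /c2 mulrA -rmorphM invfM mulrA mulfV // mul1r.
pose u n := io (al1 ^+ n) * c1 + io (al2 ^+ n) * c2.
have uN : u N = y1.
  rewrite /u c1N c2N; transitivity (d * (io al1 - io al2) * y1); first by ring.
  by rewrite dP mul1r.
have uN1 : u N.+1 = y2.
  rewrite /u !exprS !rmorphM -!mulrA c1N c2N.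
  transitivity (d * (io al1 - io al2) * y2); first by ring.
  by rewrite dP mul1r.
have rec n : u n.+2 = io (al1 + al2) * u n.+1 - io (al1 * al2) * u n.
  by rewrite /u !exprS !rmorphM rmorphD; ring.
have fwd n : mu (u (N + n)%N) = beta (N + n)%N /\
    mu (u (N + n).+1) = beta (N + n).+1.
  elim: n => [|n [IH1 IH2]]; first by rewrite addn0 uN uN1.
  rewrite addnS; split=> //; rewrite rec (tvalD_distinct hT hmu).
    rewrite muN !(tvalM hmu) !mu_io nuD nuM IH1 IH2.
    exact: esym (break_next hT ab neq_ab van (@brk n)).
  rewrite muN !(tvalM hmu) !mu_io nuD nuM IH1 IH2 -mulrA.
  by move/(trop_cancel hT a0); exact: brk.
(* For n > 0 the element valued in the second component is al1 * al2 times
   u n.-1.  This component holds at N by the independence of y1 and y2, and below N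
   because a * beta n <> b * beta n. *)
pose Q n := [/\ mu (u n) = beta n,
  mu (io (al1 + al2) * u n - u n.+1) = a * beta n + beta n.+1 & beta n != 0].
have bwd_step n : (n < N)%N -> Q n.+1 -> Q n.
  move=> nN [q1 q2 q3]; have en := geo n nN.
  have [b0 _] := geo_break (leq_ltn_trans (leq0n _) nN).
  have bn0 : beta n != 0 by apply: contraNneq q3 => z; rewrite en z mulr0.
  have q : mu (u n) = beta n.
    apply: (trop_cancel hT (trop_mul_neq0 hT a0 b0)).
    rewrite -{1}nuM -mu_io -(tvalM hmu).
    have -> : io (al1 * al2) * u n = io (al1 + al2) * u n.+1 - u n.+2.
      by rewrite rec; ring.
    exact: etrans q2 (before_break hT van en).
  split=> //.
  rewrite (tvalD_distinct hT hmu) ?muN !(tvalM hmu) !mu_io nuD ?q ?q1 //.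
  by rewrite en ![_ * beta n]mulrC => /(trop_cancel hT bn0).
have bwd k : (0 < N)%N -> (k <= N)%N -> Q (N - k)%N.
  move=> N0; elim: k => [_|k IH kN].
    by rewrite subn0; split; rewrite ?uN ?uN1 //; have [] := geo_break N0.
  apply: bwd_step; first by rewrite ltn_subrL.
  by rewrite -subSn // subSS; apply: IH; exact: ltnW.
exists L, io, mu, u; split=> // n; have [Nn|nN] := leqP N n.
  by rewrite -(subnKC Nn); have [] := fwd (n - N)%N.
have [] := @bwd (N - n)%N; rewrite ?leq_subr ?(leq_ltn_trans (leq0n _) nN) //.
by rewrite (subKn (ltnW nN)).
Qed.

(** * The semirings T and T^(2), and leading terms of power series *)

Lemma trop_leE (R : realType) (x y : trop R) : trle x y <-> tle <=%R x y.
Proof.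
rewrite /trle /GRing.add /= /tmin; case: ifP => // xy; split=> // yx.
by move: xy; rewrite -yx; case: y {yx} => //= r; rewrite lexx.
Qed.

Lemma trop2_leE (R : realType) (x y : trop2 R) : trle x y <-> tle (@lex2 R) x y.
Proof.
rewrite /trle /GRing.add /= /tmin; case: ifP => // xy; split=> // yx.
by move: xy; rewrite -yx; case: y {yx} => //= r; rewrite /lex2 lexx.
Qed.

Lemma trop_tropical (R : realType) : tropical_semiring (trop R).
Proof.
split=> [x y|].
  by rewrite /GRing.add /= /tmin; case: ifP; [left|right].
move=> [z|] [x|] [y|] //= _; rewrite /GRing.mul //=.
by move=> [/addrI ->].
Qed.

Lemma trop2_tropical (R : realType) : tropical_semiring (trop2 R).
Proof.
split=> [x y|].
  by rewrite /GRing.add /= /tmin; case: ifP; [left|right].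
move=> [z|] [x|] [y|] //= _; rewrite /GRing.mul //=.
by move=> /(@Some_inj _ _ _) /addrI ->.
Qed.

Lemma tropical_valuationP (R : realType) (K : fieldType) (nu : K -> trop R) :
  valuation nu -> tropical_valuation nu.
Proof. by case=> h0 hM hD; split=> // x y; apply/trop_leE; exact: hD. Qed.

Section Leading.
Variables (R : realType).

Lemma leading0 (A : nmodType) (val : A -> trop R) : leading val 0 = 0.
Proof. by rewrite /leading; case: pselect => // -[i]; rewrite eqxx. Qed.

Lemma leadingE (A : nmodType) (val : A -> trop R) (x : fps A) m :
  x m != 0 -> (forall i, (i < m)%N -> x i = 0) ->
  leading val x = omap (pair m%:R) (val (x m)).
Proof.
move=> xm xlt; rewrite /leading; case: pselect => [ex|]; last by case; exists m.
case: ex_minnP => n xn minn; suff -> : n = m by [].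
apply/eqP; rewrite eqn_leq minn //= leqNgt; apply: contra xn => /xlt ->.
by [].
Qed.

Variant leading_spec (A : nmodType) (val : A -> trop R) (x : fps A) :
    trop2 R -> Prop :=
| Leading0 of (forall i, x i = 0) : leading_spec val x 0
| LeadingS m of x m != 0 & (forall i, (i < m)%N -> x i = 0) :
    leading_spec val x (omap (pair m%:R) (val (x m))).

Lemma leadingP (A : nmodType) (val : A -> trop R) (x : fps A) :
  leading_spec val x (leading val x).
Proof.
rewrite /leading; case: pselect => [ex|nex].
  case: ex_minnP => m xm minm; constructor=> // i; apply: contraTeq.
  by rewrite -leqNgt; exact: minm.
by constructor => i; apply: contrapT => /eqP xi; apply: nex; exists i.
Qed.

(** Leading terms depend only on the values of the coefficients; this identifies
    the map w on T[[t]] with the map v on power series having these values. *)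
Lemma leading_map (A B : nmodType) (v1 : A -> trop R) (v2 : B -> trop R)
    (x : fps A) (y : fps B) :
  (forall i, x i = 0 <-> y i = 0) -> (forall i, v1 (x i) = v2 (y i)) ->
  leading v1 x = leading v2 y.
Proof.
move=> xy v12; case: (leadingP v1 x) => [x0|m xm xlt].
  suff -> : y = 0 by rewrite leading0.
  by apply: fpsP => i; apply/xy.
rewrite v12; symmetry; apply: leadingE.
  by apply: contra_neq xm => /xy.
by move=> i /xlt /xy.
Qed.

Section Valued.
Variables (A : comNzRingType) (mu : A -> trop R) (hmu : tropical_valuation mu).
Let hT := trop_tropical R.
Let hT2 := trop2_tropical R.

Lemma mu_Some x : x != 0 -> exists r, mu x = Some r.
Proof.
by move=> x0; have := tval_neq0 hmu x0; case: (mu x) => // r _; exists r.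
Qed.

(** Lower bounds of a leading term, as a condition on the coefficients that is
    visibly stable under addition of power series. *)
Lemma le_leading m r (x : fps A) :
  trle (Some (m%:R, r) : trop2 R) (leading mu x) <->
  (forall i, (i < m)%N -> x i = 0) /\ trle (Some r : trop R) (mu (x m)).
Proof.
rewrite trop2_leE trop_leE; case: leadingP => [x0|n xn xlt].
  by split=> // _; split=> [i _|]; rewrite ?x0 ?(tval0 hmu).
have [s es] := mu_Some xn; rewrite es /= /lex2 leEprodlexi /= ler_nat.
case: (ltngtP m n) => [mn|nm|->] /=.
- rewrite ler_nat leqNgt mn /=; split=> // _; split=> [i im|].
    by rewrite xlt ?(ltn_trans im).
  by rewrite xlt ?(tval0 hmu).
- by split=> // -[/(_ n nm)] /eqP; rewrite (negPf xn).
- by rewrite lexx es /=; split=> [|[]].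
Qed.

Lemma leading_neq0 (x : fps A) :
  x <> 0 -> exists m r, leading mu x = Some (m%:R, r).
Proof.
case: leadingP => [x0|m xm _ _]; first by case; apply: fpsP => i; rewrite x0.
by have [r ->] := mu_Some xm; exists m, r.
Qed.

(** The leading coefficients have a nonzero product, because a multiplicative mu
    excludes zero divisors; so they give the leading term of the product. *)
Lemma leading_valuation : tropical_valuation (leading mu).
Proof.
split=> [x|x y|].
- split=> [|->]; last exact: leading0.
  by apply: contraPP => /leading_neq0[m [r ->]].
- case: (leadingP mu x) => [x0|m xm xlt].
    have -> : x = 0 by apply: fpsP => i; rewrite x0.
    by rewrite mul0r leading0 mul0r.
  case: (leadingP mu y) => [y0|n yn ylt].
    have -> : y = 0 by apply: fpsP => i; rewrite y0.
    by rewrite mulr0 leading0 mulr0.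
  have exy : (x * y) (m + n)%N = x m * y n.
    have mlt : (m < (m + n).+1)%N by rewrite ltnS leq_addr.
    rewrite fps_coefM (bigD1 (Ordinal mlt)) //= addKn big1 ?addr0 // => j jm.
    have [jltm|mj] := ltnP j m; first by rewrite xlt ?mul0r.
    rewrite ylt ?mulr0 // ltn_subLR ?leq_ord // ltn_add2r ltn_neqAle mj andbT.
    by apply: contra jm => /eqP e; apply/eqP/val_inj.
  have [r er] := mu_Some xm; have [s es] := mu_Some yn.
  have mxy : mu (x m * y n) = Some (r + s) by rewrite (tvalM hmu) er es.
  rewrite (@leadingE _ _ (x * y) (m + n)) ?exy.
  + rewrite er es mxy /= natrD. by [].
  + by apply/eqP => /(tval_eq0 hmu); rewrite mxy.
  move=> i imn; rewrite fps_coefM big1 // => j _.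
  have [jltm|mj] := ltnP j m; first by rewrite xlt ?mul0r.
  by rewrite ylt ?mulr0 // ltn_subLR ?leq_ord // (leq_trans imn) // leq_add2r.
suff H x y : trle (leading mu x) (leading mu y) ->
    trle (leading mu x) (leading mu (x + y)).
  move=> x y.
  case: (trop_selective hT2 (leading mu x) (leading mu y)) => e; rewrite e.
    exact: H.
  by rewrite addrC; apply: H; rewrite /trle addrC.
have [->|x0] := pselect (x = 0); first by rewrite leading0 add0r.
have [m [r e]] := leading_neq0 x0.
have [x1 x2] : (forall i, (i < m)%N -> x i = 0) /\
    trle (Some r : trop R) (mu (x m)).
  by apply/le_leading; rewrite -e; exact: (trle_refl hT2).
rewrite e => /((le_leading m r y).1)[y1 y2]; apply/le_leading; split.
  by move=> i im; rewrite fps_coefD x1 // y1 // addr0.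
by apply: trle_trans (tvalD hmu _ _); exact: trle_addr.
Qed.

End Valued.
End Leading.

(** * Evaluation of differential polynomials and their tropicalizations *)

Section FpsMap.
Variables (A B : comNzRingType) (f : {rmorphism A -> B}).

Definition fps_map (x : fps A) : fps B := Fps (fun n => f (x n)).

Fact fps_map_zmod_morphism : zmod_morphism fps_map.
Proof. by move=> x y; apply: fpsP => n /=; rewrite rmorphB. Qed.

Fact fps_map_monoid_morphism : monoid_morphism fps_map.
Proof.
split=> [|x y]; apply: fpsP => n /=.
  by case: n => [|n] /=; rewrite ?rmorph1 ?rmorph0.
by rewrite rmorph_sum; apply: eq_bigr => j _; rewrite rmorphM.
Qed.

HB.instance Definition _ :=
  GRing.isZmodMorphism.Build (fps A) (fps B) fps_map fps_map_zmod_morphism.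
HB.instance Definition _ :=
  GRing.isMonoidMorphism.Build (fps A) (fps B) fps_map fps_map_monoid_morphism.

End FpsMap.

Lemma fpsCM (A : nzRingType) (c : A) (x : fps A) n : (fpsC c * x) n = c * x n.
Proof.
rewrite fps_coefM big_ord_recl subn0 big1 ?addr0 // => j _.
by rewrite /= mul0r.
Qed.

Section PowerProduct.
Variables (L : comNzRingType) (Y : nat -> L).

(** The monomial m evaluated at x^(j) := Y j. *)
Definition power_product (m : {cmonom nat}) : L :=
  \prod_(j <- finsupp m) Y j ^+ m j.

Lemma power_productEw (m : {cmonom nat}) (d : {fset nat}) :
  (finsupp m `<=` d)%fset -> power_product m = \prod_(j <- d) Y j ^+ m j.
Proof.
move=> le_d; apply: big_fset_incl => // j _.
by rewrite -cmE_eq0 => /eqP ->.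
Qed.

Fact power_product_mmorphism : mmorphism power_product.
Proof.
split=> [m1 m2|]; last by rewrite /power_product mdom1 big_seq_fset0.
rewrite (power_productEw (m := mmul m1 m2)
  (d := (finsupp m1 `|` finsupp m2)%fset)); last by rewrite mdomD.
rewrite (power_productEw (fsubsetUl (finsupp m1) (finsupp m2))).
rewrite (power_productEw (fsubsetUr (finsupp m1) (finsupp m2))) -big_split /=.
by apply: eq_bigr => j _; rewrite cmM exprD.
Qed.

HB.instance Definition _ :=
  isMultiplicative.Build {cmonom nat} L power_product power_product_mmorphism.

Lemma power_productU j : power_product (ucm j) = Y j.
Proof. by rewrite /power_product mdomU big_seq_fset1 cmUU expr1. Qed.

End PowerProduct.

Definition linear_ode (K : fieldType) (al1 al2 : K) : {dpoly (fps K)} :=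
    dvar _ 2 - (fpsC (al1 + al2))%:MP * dvar _ 1
      + (fpsC (al1 * al2))%:MP * dvar _ 0.

Lemma iter_deriv_linear_ode (K : fieldType) (al1 al2 : K) n :
  iter n (@fps_dpoly_deriv K) (linear_ode al1 al2) =
    dvar _ n.+2 - (fpsC (al1 + al2))%:MP * dvar _ n.+1
      + (fpsC (al1 * al2))%:MP * dvar _ n.
Proof.
have D0 : fps_dpoly_deriv (0 : {dpoly (fps K)}) = 0.
  by apply: (addrI (fps_dpoly_deriv 0)); rewrite -fps_dpoly_derivD !addr0.
have DN f : fps_dpoly_deriv (- f) = - fps_dpoly_deriv f :> {dpoly (fps K)}.
  by apply/eqP; rewrite -addr_eq0 -fps_dpoly_derivD addNr D0.
have DC (c : K) f : fps_dpoly_deriv ((fpsC c)%:MP * f) =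
    (fpsC c)%:MP * fps_dpoly_deriv f :> {dpoly (fps K)}.
  rewrite fps_dpoly_derivM fps_dpoly_derivC.
  have -> : fps_deriv (fpsC c) = 0 by apply: fpsP => i /=; rewrite mul0rn.
  by rewrite malgC0E mul0r add0r.
have Dlin (c d : K) (f2 f1 f0 : {dpoly (fps K)}) :
    fps_dpoly_deriv (f2 - (fpsC c)%:MP * f1 + (fpsC d)%:MP * f0) =
    fps_dpoly_deriv f2 - (fpsC c)%:MP * fps_dpoly_deriv f1 +
      (fpsC d)%:MP * fps_dpoly_deriv f0.
  apply: etrans (fps_dpoly_derivD _ _) _; apply: (f_equal2 +%R); last exact: DC.
  apply: etrans (fps_dpoly_derivD _ _) _; apply: (f_equal2 +%R) => //.
  by apply: etrans (DN _) _; apply: (congr1 -%R); exact: DC.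
elim: n => [//|n IH]; apply: etrans (congr1 _ IH) _.
apply: etrans (Dlin _ _ _ _ _) _.
have e := @fps_dpoly_deriv_var K.
exact: (f_equal2 +%R (f_equal2 +%R (e _) (congr1 -%R (congr1 _ (e _))))
  (congr1 _ (e _))).
Qed.

Section Terms.
Variables (R : realType) (K : fieldType) (nu : K -> trop R).
Implicit Types (f : {dpoly (fps K)}) (B : fps (trop R)).
Hypothesis hnu : tropical_valuation nu.
Let hT2 := trop2_tropical R.
Let hv : tropical_valuation (vlead nu) := leading_valuation hnu.

Lemma trop_polyE f m : trop_poly nu f m = vlead nu f@_m.
Proof.
rewrite fsfun_fun; case: ifP => // /negbT /mcoeff_outdom ->.
by rewrite (tval0 hv).
Qed.

Lemma finsupp_trop_poly f : finsupp (trop_poly nu f) = msupp f.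
Proof.
apply/fsetP => m; rewrite mem_finsupp trop_polyE -mcoeff_neq0.
apply/idP/idP => [|/(tval_neq0 hv)//].
by apply: contra_neq => ->; rewrite (tval0 hv).
Qed.

Lemma tropical_solution_vanishes (f : tropical_poly R) B :
  tropical_solution nu f B <->
  tropically_vanishes (finsupp f) (term_eval nu f B).
Proof.
split=> [[s0|[m1 [m2 [s1 s2 ne e1 e2]]]]|/(vanishes_attained_twice hT2)[|]].
- have z m : m \in finsupp f -> term_eval nu f B m = 0.
    move=> sm; have := trle_sum_term hT2 (P := predT) (term_eval nu f B) sm isT.
    by rewrite -/(trop_eval nu f B) s0 /trle add0r.
  move=> m _; rewrite [LHS]big_seq_cond [RHS]big_seq_cond.
  by rewrite !big1 // => k /andP[sk _]; exact: z.
- exact: (attained_twice_vanishes hT2 s1 s2 ne e1 e2).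
- by left.
- by move=> [m1 [m2 [s1 s2 ne e1 e2]]]; right; exists m1, m2; split.
Qed.

End Terms.

Lemma vanishes_widen (T : comNzSemiRingType) (I : choiceType) (d e : {fset I})
    (F : I -> T) : (d `<=` e)%fset ->
  (forall i, i \in e -> i \notin d -> F i = 0) ->
  tropically_vanishes d F -> tropically_vanishes e F.
Proof.
move=> de F0 van i ie.
rewrite big_mkcond -(big_fset_incl _ de) //=; last first.
  by move=> k ke kd; rewrite F0 // if_same.
rewrite -(big_fset_incl _ de F0) -big_mkcond /=.
have [|id] := boolP (i \in d); first exact: van.
rewrite big_seq_cond [RHS]big_seq_cond; apply: eq_bigl => k.
case kd: (k \in d) => //=.
by apply: contraNneq id => <-.
Qed.

Lemma vanishes_three (T : comNzSemiRingType) (I : choiceType) (F : I -> T)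
    (i j k : I) : i != j -> i != k -> j != k ->
  tropically_vanishes [fset i; j; k]%fset F ->
  F i + F j = F j + F k /\ F i + F k = F j + F k.
Proof.
move=> ij ik jk van.
have sumE (P : pred I) : \sum_(l <- [fset i; j; k]%fset | P l) F l =
    (if P i then F i else 0) + (if P j then F j else 0) +
    (if P k then F k else 0).
  rewrite big_mkcond -fsetUA big_fsetU1 ?inE ?negb_or ?ij //=.
  by rewrite big_fsetU1 ?inE // big_seq_fset1 addrA.
have := van i; have := van j; have := van k.
rewrite !sumE !inE !eqxx ?orbT /= ij ik jk ![_ == i]eq_sym ![k == j]eq_sym.
rewrite (negPf ij) (negPf ik) (negPf jk) /=.
rewrite !addr0 !add0r => /(_ isT) e3 /(_ isT) e2 /(_ isT) e1.
by split; [exact: etrans e3 (esym e1) | exact: etrans e2 (esym e1)].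
Qed.

(** * From the derivatives of F to a tropical recurrence *)

Section ConstantPart.
Variable R : realType.

(** The projection of T^(2) onto the terms of t-order 0.  On elements of
    nonnegative t-order it commutes with the minimum, since terms of positive
    order are larger than those of order 0. *)
Definition constant_part (x : trop2 R) : trop R :=
  if x is Some (m, r) then if m == 0 then Some r else None else None.

Definition lead_nonneg (x : trop2 R) : bool :=
  if x is Some (m, _) then 0 <= m else true.

Lemma constant_partD (x y : trop2 R) : lead_nonneg x -> lead_nonneg y ->
  constant_part (x + y) = constant_part x + constant_part y.
Proof.
case: x y => [[m r]|] [[n s]|] //=; rewrite ?add0r ?addr0 //.
rewrite {1}/GRing.add /= /tmin /= /lex2 leEprodlexi /=.
have [->|m0] := eqVneq m 0; have [->|n0] := eqVneq n 0 => //=.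
- move=> _ _; rewrite lexx /= {1}/GRing.add /= /tmin /=.
  by case: ifP; rewrite /= eqxx.
- move=> _ n_ge0; rewrite n_ge0 leNgt lt_def n0 n_ge0 /= eqxx.
  by rewrite [RHS]addrC [RHS]add0r.
- move=> m_ge0 _; rewrite leNgt lt_def m0 m_ge0 /= eqxx.
  by rewrite [RHS]add0r.
- move=> _ _; rewrite [RHS]add0r; case: ifP => _ /=.
    by rewrite (negPf m0).
  by rewrite (negPf n0).
Qed.

Definition trop2_const (t : trop R) : trop2 R := omap (pair 0) t.

Lemma constant_partM (t : trop R) (x : trop2 R) :
  constant_part (trop2_const t * x) = t * constant_part x.
Proof.
case: t x => [t|] [[m r]|] //=; rewrite /GRing.mul /= add0r.
by case: eqP.
Qed.

Lemma lead_nonnegM (t : trop R) (x : trop2 R) :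
  lead_nonneg x -> lead_nonneg (trop2_const t * x).
Proof. by case: t x => [t|] [[m r]|] //=; rewrite add0r. Qed.

Lemma constant_part_wlead (z : fps (trop R)) : constant_part (wlead z) = z 0%N.
Proof.
rewrite /wlead; case: leadingP => [->//|m zm zlt] /=.
case ez: (z m) zm => [r|//] _ /=; rewrite pnatr_eq0.
case: m ez zlt => [|m] ez zlt /=; first by rewrite ez.
by rewrite zlt.
Qed.

Lemma lead_nonneg_wlead (z : fps (trop R)) : lead_nonneg (wlead z).
Proof.
rewrite /wlead; case: leadingP => // m _ _.
by case: (z m) => //= r; rewrite ler0n.
Qed.

End ConstantPart.

Lemma leading_fpsC (R : realType) (A : comNzRingType) (mu : A -> trop R)
  (hmu : tropical_valuation mu) (c : A) :
  leading mu (fpsC c) = trop2_const (mu c).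
Proof.
have [->|c0] := eqVneq c 0.
  rewrite (tval0 hmu) -[RHS](leading0 mu); congr (leading mu _).
  by apply: fpsP => -[].
by rewrite (@leadingE _ _ _ (fpsC c) 0).
Qed.

Lemma ucm_eq (i j : nat) : (ucm i == ucm j :> {cmonom nat}) = (i == j).
Proof.
apply/eqP/eqP => [/(congr1 (fun m : {cmonom nat} => m j))|-> //].
by rewrite !cmU eqxx; case: eqVneq.
Qed.

Lemma mcoeff_lin (A : comNzRingType) (c d : A) (X Y Z : {dpoly A}) m :
  (X - c%:MP * Y + d%:MP * Z)@_m = X@_m - c * Y@_m + d * Z@_m.
Proof.
apply: etrans (mcoeffD _ _ _) _; apply: (f_equal2 +%R); last exact: mcoeffCM.
apply: etrans (mcoeffB _ _ _) _; apply: (f_equal2 +%R) => //.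
by apply: (congr1 -%R); exact: mcoeffCM.
Qed.

Lemma mcoeff_dvar (A : comNzRingType) (j : nat) m :
  (dvar A j)@_m = (ucm j == m)%:R.
Proof. exact: mcoeffU. Qed.

Lemma coef_three_vars (A : comNzRingType) (c d : A) (i j k l : nat) :
  (dvar A i - c%:MP * dvar A j + d%:MP * dvar A k)@_(ucm l) =
    (i == l)%:R - c *+ (j == l) + d *+ (k == l).
Proof.
have e a : (dvar A a)@_(ucm l) = (a == l)%:R.
  by apply: etrans (mcoeff_dvar _ _ _) _; rewrite ucm_eq.
apply: etrans (mcoeff_lin _ _ _ _ _ _) _.
apply: (f_equal2 +%R); [apply: (f_equal2 +%R); first exact: e | ].
  by apply: (congr1 -%R); apply: etrans (congr1 _ (e _)) _; exact: mulr_natr.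
by apply: etrans (congr1 _ (e _)) _; exact: mulr_natr.
Qed.

Lemma notin_fset3 (I : choiceType) (i j k l : I) :
  l \notin [fset i; j; k]%fset -> [/\ l != i, l != j & l != k].
Proof. by rewrite !inE !negb_or => /andP[/andP[]]. Qed.

Lemma msupp_three_vars (A : comNzRingType) (c d : A) (i j k : nat) :
  (msupp (dvar A i - c%:MP * dvar A j + d%:MP * dvar A k) `<=`
    [fset ucm i; ucm j; ucm k])%fset.
Proof.
apply/fsubsetP => m; apply: contraTT => mS.
have [mi mj mk] := notin_fset3 mS.
have notin (X : {dpoly A}) : X@_m = 0 -> m \notin msupp X.
  by move=> X0; rewrite -mcoeff_eq0 X0.
apply: notin; apply: etrans (mcoeff_lin _ _ _ _ _ _) _.
have e a : m != ucm a -> (dvar A a)@_m = 0.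
  by move=> ma; apply: etrans (mcoeff_dvar _ _ _) _; rewrite eq_sym (negPf ma).
apply: etrans (f_equal2 (fun x y => x + d * y) (f_equal2 (fun x y => x - c * y)
  (e i mi) (e j mj)) (e k mk)) _.
by rewrite !mulr0 subr0 addr0.
Qed.

Section Descent.
Variables (R : realType) (K : fieldType) (nu : K -> trop R).
Hypothesis hnu : tropical_valuation nu.
Variables (al1 al2 : K).
Let hT := trop_tropical R.
Let hT2 := trop2_tropical R.
Let hv : tropical_valuation (vlead nu) := leading_valuation hnu.

(** All three terms of trop(d^n F) at B have nonnegative t-order, and
    [constant_part] sends the value of x^(k) to the constant coefficient of the
    k-th derivative of B.  The distinct valuations give al1 + al2 the valuation
    of al1. *)
Lemma solution_vanishes_at0 (B : fps (trop R)) n :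
  nu al1 <> nu al2 -> trle (nu al1) (nu al2) ->
  Sol nu (trop_poly nu (iter n (@fps_dpoly_deriv K) (linear_ode al1 al2))) B ->
  let beta k := iter k (trop_deriv nu) B 0%N in
  beta n.+2 + nu al1 * beta n.+1 =
    nu al1 * beta n.+1 + nu al1 * nu al2 * beta n /\
  beta n.+2 + nu al1 * nu al2 * beta n =
    nu al1 * beta n.+1 + nu al1 * nu al2 * beta n.
Proof.
move=> ne le12 /tropical_solution_vanishes.
rewrite iter_deriv_linear_ode; set G := (X in trop_poly nu X).
have coefG k : G@_(ucm k) = _ := coef_three_vars (fpsC (al1 + al2))
  (fpsC (al1 * al2)) n.+2 n.+1 n k.
move=> van; have {van} : tropically_vanishes
    [fset ucm n.+2; ucm n.+1; ucm n]%fset (term_eval nu (trop_poly nu G) B).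
  apply: vanishes_widen van; last first.
    by move=> m _ mG; rewrite /term_eval fsfun_dflt // mul0r.
  by rewrite finsupp_trop_poly //; exact: msupp_three_vars.
have ne_ucm k l : (k < l)%N -> ucm l != ucm k :> {cmonom nat}.
  by rewrite ucm_eq => /gtn_eqF ->.
move=> /(vanishes_three (ne_ucm _ _ (ltnSn _)) (ne_ucm _ _ (leqnSn _))
  (ne_ucm _ _ (ltnSn _))).
have wE k : term_eval nu (trop_poly nu G) B (ucm k) =
    vlead nu G@_(ucm k) * wlead (iter k (trop_deriv nu) B).
  rewrite /term_eval (trop_polyE hnu).
  by rewrite mdomU big_seq_fset1 cmUU expr1.
have vlC c : vlead nu (fpsC c) = trop2_const (nu c) by exact: leading_fpsC.
have s2 : vlead nu G@_(ucm n.+2) = trop2_const 1.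
  rewrite (coefG n.+2) eqxx (ltn_eqF (ltnSn _)) (ltn_eqF (leqnSn _)).
  by rewrite !mulr0n subr0 addr0 -(tval1 hT hnu) -vlC.
have s1 : vlead nu G@_(ucm n.+1) = trop2_const (nu al1).
  rewrite (coefG n.+1) eqxx (ltn_eqF (ltnSn _)) (gtn_eqF (ltnSn _)).
  rewrite !mulr0n add0r addr0 (tvalN hT2 hv) vlC (tvalD_distinct hT hnu) //.
  by rewrite le12.
have s0 : vlead nu G@_(ucm n) = trop2_const (nu al1 * nu al2).
  rewrite (coefG n) eqxx (gtn_eqF (ltnSn _)) (gtn_eqF (leqnSn _)).
  by rewrite !mulr0n subr0 add0r vlC (tvalM hnu).
rewrite !wE s2 s1 s0 => -[e1 e2] beta.
have := congr1 (@constant_part R) e1; have := congr1 (@constant_part R) e2.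
rewrite !constant_partD ?lead_nonnegM ?lead_nonneg_wlead //.
by rewrite !constant_partM !constant_part_wlead mul1r.
Qed.

End Descent.

(** * From a lift of the recurrence to all equations of the ideal *)

(** In characteristic q, the identity p^q = p of Fermat would give
    q * nu p = nu p. *)
Lemma valued_natr_neq0 (R : realType) (p : nat) (K : fieldType)
    (nu : K -> trop R) n :
  tropical_valuation nu -> nu p%:R = Some 1 -> (0 < n)%N -> n%:R != 0 :> K.
Proof.
move=> hnu nup n0; have hT := trop_tropical R.
apply/negP => nK; have [q qK] := natf0_pchar n0 nK.
have := congr1 nu (pFrobenius_autE qK p%:R).
rewrite pFrobenius_aut_nat (tvalX hT hnu) nup.
have -> k : (Some 1 : trop R) ^+ k = Some k%:R.
  elim: k => [//|k IH]; rewrite exprS IH [LHS]/= {1}/GRing.mul /=.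
  by rewrite -natr1 addrC.
move=> [] /eqP; rewrite eq_sym pnatr_eq1 => /eqP q1.
by have := pcharf_prime qK; rewrite q1.
Qed.

(** The tropical counterpart of i! y^(j)_i = (i + j)! y_(i + j). *)
Lemma iter_trop_deriv (R : realType) (K : fieldType) (nu : K -> trop R)
    (hnu : tropical_valuation nu) (B : fps (trop R)) j i :
  nu i`!%:R * iter j (trop_deriv nu) B i = nu (i + j)`!%:R * B (i + j)%N.
Proof.
elim: j i => [|j IH] i; first by rewrite addn0.
by rewrite iterS /= mulrA -(tvalM hnu) -natrM mulnC -factS IH addSnnS.
Qed.

Section Ascent.
Variables (R : realType) (K : fieldType) (nu : K -> trop R).
Hypothesis hnu : tropical_valuation nu.
Hypothesis natK : forall n, (0 < n)%N -> n%:R != 0 :> K.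
Variables (al1 al2 : K) (B : fps (trop R)).
Variables (L : comNzRingType) (iota : {rmorphism K -> L}) (mu : L -> trop R).
Hypothesis hmu : tropical_valuation mu.
Hypothesis mu_iota : forall k, mu (iota k) = nu k.
Variable u : nat -> L.
Hypothesis u_rec :
  forall n, u n.+2 = iota (al1 + al2) * u n.+1 - iota (al1 * al2) * u n.
Hypothesis mu_u : forall n, mu (u n) = iter n (trop_deriv nu) B 0%N.
Let hT := trop_tropical R.
Let hT2 := trop2_tropical R.

Let y : fps L := Fps (fun n => iota n`!%:R^-1 * u n).
Let Y j : fps L := iter j (@fps_deriv L) y.

Let factK n : n`!%:R != 0 :> K. Proof. exact/natK/fact_gt0. Qed.

Let YE j i : Y j i = iota i`!%:R^-1 * u (i + j)%N.
Proof.
rewrite /Y; elim: j i => [|j IH] i; first by rewrite addn0.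
rewrite iterS [LHS]/= IH addSnnS -mulrnAl -rmorphMn factS natrM invfM.
by rewrite -mulrnAl -[X in iota (X * _)]mulr_natr mulVf ?mul1r // natK.
Qed.

Let mu_Y j i : mu (Y j i) = iter j (trop_deriv nu) B i.
Proof.
have f0 := tval_neq0 hnu (factK i); apply: (trop_cancel hT f0).
rewrite (iter_trop_deriv hnu) YE (tvalM hmu) mulrA mu_iota -(tvalM hnu).
rewrite mulfV //.
rewrite (tval1 hT hnu) mul1r mu_u.
have := iter_trop_deriv hnu B (i + j) 0.
by rewrite fact0 (tval1 hT hnu) mul1r add0n.
Qed.

Let Y_rec j : Y j.+2 - fps_map iota (fpsC (al1 + al2)) * Y j.+1 +
  fps_map iota (fpsC (al1 * al2)) * Y j = 0.
Proof.
have mapC c : fps_map iota (fpsC c) = fpsC (iota c).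
  by apply: fpsP => -[|n] //=; rewrite rmorph0.
apply: fpsP => i; rewrite !mapC fps_coefD.
have -> : (Y j.+2 - fpsC (iota (al1 + al2)) * Y j.+1) i =
  Y j.+2 i - (fpsC (iota (al1 + al2)) * Y j.+1) i by [].
by rewrite !fpsCM !YE !addnS u_rec fps_coef0; ring.
Qed.

Let ev : {rmorphism {dpoly (fps K)} -> fps L} :=
  mmap (fps_map iota) (power_product Y).

Let ev_dvar j : ev (dvar _ j) = Y j.
Proof.
apply: etrans (mmapU _ _) _.
apply: etrans (f_equal2 *%R (rmorph1 (fps_map iota)) (power_productU Y j)) _.
exact: mul1r.
Qed.

Let ev_C c : ev c%:MP = fps_map iota c.
Proof. exact: mmapC. Qed.

Let ev_ode n : ev (iter n (@fps_dpoly_deriv K) (linear_ode al1 al2)) = 0.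
Proof.
apply: etrans (congr1 ev (iter_deriv_linear_ode _ _ _)) _.
apply: etrans (Y_rec n).
apply: etrans (rmorphD ev _ _) _; apply: (f_equal2 +%R).
  apply: etrans (rmorphB ev _ _) _; apply: (f_equal2 +%R); first exact: ev_dvar.
  apply: (congr1 -%R); apply: etrans (rmorphM ev _ _) _.
  by apply: (f_equal2 *%R); [exact: ev_C | exact: ev_dvar].
apply: etrans (rmorphM ev _ _) _.
by apply: (f_equal2 *%R); [exact: ev_C | exact: ev_dvar].
Qed.

Let ev_ideal g :
  diff_ideal (@fps_dpoly_deriv K) (linear_ode al1 al2) g -> ev g = 0.
Proof.
move=> /(diff_idealP (@fps_dpoly_derivD K) (@fps_dpoly_derivM K))[n [h ->]].
apply: etrans (rmorph_sum ev _ _ _) _; apply: big1 => i _.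
apply: etrans (rmorphM ev _ _) _; apply: etrans (congr1 _ (ev_ode i)) _.
exact: mulr0.
Qed.

(** Evaluation at y is a ring morphism that kills [F], so it turns the terms of
    an element of [F] into a vanishing sum.  Their leading terms are the
    tropical terms evaluated at B. *)
Lemma lifted_solution g :
  diff_ideal (@fps_dpoly_deriv K) (linear_ode al1 al2) g ->
  Sol nu (trop_poly nu g) B.
Proof.
move=> /ev_ideal evg; apply/tropical_solution_vanishes.
rewrite finsupp_trop_poly //.
pose z (m : {cmonom nat}) : fps L := fps_map iota g@_m * power_product Y m.
have hv := leading_valuation hmu.
have van := tval_vanishes hT2 hv (F := z) (fset_uniq (msupp g)) evg.
have zE m : term_eval nu (trop_poly nu g) B m = leading mu (z m).
  rewrite /term_eval (trop_polyE hnu) /z (tvalM hv) (tval_prod hT2 hv).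
  congr (_ * _).
    apply: leading_map => i /=; last by rewrite mu_iota.
    by rewrite -(tval_eq0 hmu) mu_iota (tval_eq0 hnu).
  apply: eq_bigr => j _; rewrite (tvalX hT2 hv); congr (_ ^+ _).
  apply: leading_map => i; last by rewrite mu_Y.
  by rewrite -mu_Y (tval_eq0 hmu).
by move=> m mg; rewrite !(eq_bigr _ (fun m _ => zE m)); exact: van.
Qed.

End Ascent.

Lemma diff_ideal_iter (S : comNzRingType) (d : S -> S) (f : S) n :
  diff_ideal d f (iter n d f).
Proof.
move=> I [_ _ _ dI] If; elim: n => //= n; exact: dI.
Qed.

Lemma linear_odeC (K : fieldType) (al1 al2 : K) :
  linear_ode al1 al2 = linear_ode al2 al1.
Proof.
exact: (f_equal2 (fun s q : K => dvar _ 2 - (fpsC s)%:MP * dvar _ 1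
  + (fpsC q)%:MP * dvar _ 0) (addrC _ _) (mulrC _ _)).
Qed.

Lemma linear_ode_tropical_basis (R : realType) (K : fieldType)
    (nu : K -> trop R) (al1 al2 : K) :
  tropical_valuation nu -> (forall n, (0 < n)%N -> n%:R != 0 :> K) ->
  trle (nu al1) (nu al2) -> nu al1 <> nu al2 ->
  differential_tropical_basis nu [set linear_ode al1 al2]
    (diff_ideal (@fps_dpoly_deriv K) (linear_ode al1 al2)).
Proof.
move=> hnu natK le12 ne12; split.
  by move=> _ ->; move=> J _.
apply/seteqP; split=> B solB.
  move=> _ -> n _; pose f := iter n (@fps_dpoly_deriv K) (linear_ode al1 al2).
  apply: (solB (trop_poly nu f)); exists f => //; exact: diff_ideal_iter.
move=> _ [g gI <-].
have van n := solution_vanishes_at0 hnu ne12 le12 (solB _ erefl n I).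
have [L [iota [mu [u [hmu mu_iota u_rec mu_u]]]]] :=
  lift_recurrence (trop_tropical R) hnu le12 ne12 van.
exact: (lifted_solution hnu natK hmu mu_iota u_rec mu_u gI).
Qed.

Unset Implicit Arguments.

Theorem theorem1 (R : realType) (p : nat) (K : fieldType) (nu : K -> trop R)
    (hp : prime p) (hK : padic_complex_numbers p nu) (alpha1 alpha2 : K) :
  let F : {dpoly (fps K)} :=
    dvar _ 2 - (fpsC (alpha1 + alpha2))%:MP * dvar _ 1
      + (fpsC (alpha1 * alpha2))%:MP * dvar _ 0 in
  nu alpha1 <> nu alpha2 ->
  differential_tropical_basis nu [set F] (diff_ideal (@fps_dpoly_deriv K) F).
Proof.
move=> F ne; rewrite -[F]/(linear_ode alpha1 alpha2) {F}.
have hnu := tropical_valuationP (Cp_valuation hK).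
have natK n : (0 < n)%N -> n%:R != 0 :> K.
  exact: valued_natr_neq0 hnu (Cp_val_p hK).
case: (trop_selective (trop_tropical R) (nu alpha1) (nu alpha2)) => le12.
  exact: linear_ode_tropical_basis.
rewrite linear_odeC; apply: linear_ode_tropical_basis => //.
  by rewrite /trle addrC.
exact: nesym.
Qed.
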